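(* The inequality $$w\le\sum_{i\in S_1}\zeta(-a_i)(\mu_i-x_i)+\sum_{i\in S_0}\phi^U(a_i)x_i+\rho_s(k)(x_s-k)+g(ka_s)$$ is valid for $\mathcal{X}$. If $0\le a_i\le A_*+ka_s$ holds for all $i\in S_0$, where $A_*=\sum_{j\in S_1^+}\mu_ja_j$, then this inequality is facet-defining for $\operatorname{conv}(\mathcal{X})$.
   Context: Let $n\ge 1$, let $f:\mathbb{R}\to\mathbb{R}$ be concave, let $a\in\mathbb{R}^n$ with $a_i\ge 0$ for all $i$, and let $\mu\in\mathbb{Z}^n$ with all $\mu_i\ge 1$. Define $$\mathcal{X}=\{(w,x)\in\mathbb{R}\times\mathbb{Z}^n : w\le f(a^\top x),\ 0\le x_i\le\mu_i\ \text{for } i=1,\dots,n\}.$$ Fix $s\in\{1,\dots,n\}$ with $a_s>0$, disjoint subsets $S_0,S_1$ of $\{1,\dots,n\}\setminus\{s\}$ with $\{s\}\cup S_0\cup S_1=\{1,\dots,n\}$, and an integer $k\in\{1,\dots,\mu_s\}$. Define $g(z)=f\big(z+\sum_{i\in S_1}\mu_i a_i\big)$, $\rho_s(k)=g(ka_s)-g((k-1)a_s)$, $$\zeta(\delta)=\max\big\{g(\delta+a_s x)-\rho_s(k)(x-k)-g(ka_s) : x\in\mathbb{Z},\ 0\le x\le\mu_s\big\}\quad(\delta\in\mathbb{R}).$$ Let $S_1^+=\{i\in S_1 : a_i\ge(\mu_s-k+1)a_s\}=\{j_1,\dots,j_d\}$ (with $d=|S_1^+|\ge 0$), enumerated so that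 $a_{j_1}\ge\dots\ge a_{j_d}$. Put $A_{i,q}=\sum_{t=1}^{i-1}\mu_{j_t}a_{j_t}+q\,a_{j_i}$ for $1\le i\le d$, $0\le q\le\mu_{j_i}$, and $A_*=\sum_{t=1}^d\mu_{j_t}a_{j_t}$ ($A_*=0$ if $d=0$). The function $\phi^U:[0,\infty)\to\mathbb{R}$ is defined piecewise by: (1) $\phi^U(\delta)=g(\delta+\mu_sa_s-A_{i+1,q})-\sum_{t=1}^{i}\mu_{j_t}\zeta(-a_{j_t})-q\,\zeta(-a_{j_{i+1}})+(k-\mu_s)\rho_s(k)-g(ka_s)$ if $A_{i+1,q-1}\le\delta<A_{i+1,q}+(k-\mu_s-1)a_s$, for $i=0,\dots,d-1$, $q=1,\dots,\mu_{j_{i+1}}$; (2) $\phi^U(\delta)=g(\delta+(\mu_s-\ell)a_s-A_{i+1,q})-\sum_{t=1}^{i}\mu_{j_t}\zeta(-a_{j_t})-q\,\zeta(-a_{j_{i+1}})+(k-\mu_s+\ell)\rho_s(k)-g(ka_s)$ if $A_{i+1,q}+(k-\mu_s+\ell-1)a_s\le\delta<A_{i+1,q}+(k-\mu_s+\ell)a_s$, for $i=0,\dots,d-1$, $q=1,\dots,\mu_{j_{i+1}}$, $\ell=0,\dots,\mu_s-k$; (3) $\phi^U(\delta)=g(\delta+(\mu_s-\ell)a_s-A_* )-\sum_{t=1}^{d}\mu_{j_t}\zeta(-a_{j_t})+(k-\mu_s+\ell)\rho_s(k)-g(ka_s)$ if $A_*+(k-\mu_s+\ell-1)a_s\le\delta<A_*+(k-\mu_s+\ell)a_s$,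 for $\ell=\mu_s-k+1,\mu_s-k+2,\dots$. An inequality is valid for a set if all points of the set satisfy it; it is facet-defining for a polyhedron $P$ if it is valid for $P$ and the set of points of $P$ satisfying it with equality is a face of dimension $\dim P-1$. *)

(* Defs.v *)
From mathcomp Require Import all_boot all_order all_algebra.
From mathcomp Require Import all_classical all_reals all_analysis.

Set Implicit Arguments.
Unset Strict Implicit.
Unset Printing Implicit Defensive.

Import Order.TTheory GRing.Theory Num.Theory.

Local Open Scope classical_set_scope.
Local Open Scope ring_scope.

Definition concave (R : realType) (f : R -> R) : Prop :=
  convex_function [set: R^o] (\- f).

Section Polyhedral.
Variables (R : realType) (V : vectType R).
Implicit Types P F : set V.

Definition conv_hull P : set V := smallest (@convex_set R V) P.

Definition aff_indep m (t : 'I_m -> V) : Prop :=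
  forall c : 'I_m -> R,
    \sum_(i < m) c i = 0 -> \sum_(i < m) c i *: t i = 0 -> forall i, c i = 0.

(* Maximal number of affinely independent points, minus one (so -1 for the
   empty set); at most [\dim {:V} + 1] points can be affinely independent. *)
Definition aff_dim P : int :=
  (\max_(m < (\dim {:V}).+2 |
        `[< exists t : 'I_m -> V, aff_indep t /\ forall i, P (t i) >]) m)%:Z - 1.

Definition face P F : Prop :=
  exists (c : V -> R) (b : R),
    [/\ scalar c, forall p, P p -> c p <= b & F = [set p | P p /\ c p = b]].

(* An inequality is given by its two sides, as functions on [V]. *)
Definition valid_ineq (lhs rhs : V -> R) P : Prop :=
  forall p, P p -> lhs p <= rhs p.

Definition facet_defining (lhs rhs : V -> R) P : Prop :=
  let F := [set p | P p /\ lhs p = rhs p] in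
  [/\ valid_ineq lhs rhs P, face P F & aff_dim F = aff_dim P - 1].

End Polyhedral.

Section Lifting.
Variables (R : realType) (n : nat).
Variables (f : R -> R) (a : 'rV[R]_n) (mu : 'rV[int]_n).

(* The integer points [x] are embedded in [R^n], so that the set lives in the
   real vector space where its convex hull is taken. *)
Definition mixed_set : set (R^o * 'rV[R]_n)%type :=
  [set p | exists x : 'rV[int]_n,
     [/\ p.2 = map_mx intr x,
         p.1 <= f (\sum_i a 0 i * (x 0 i)%:~R)
       & forall i, 0 <= x 0 i <= mu 0 i]].

Variables (s : 'I_n) (S1 : {set 'I_n}) (k : int).

Definition gfun (z : R) : R := f (z + \sum_(i in S1) (mu 0 i)%:~R * a 0 i).

Definition rho : R := gfun (k%:~R * a 0 s) - gfun ((k - 1)%:~R * a 0 s).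

Definition zeta_obj (delta : R) (x : int) : R :=
  gfun (delta + a 0 s * x%:~R) - rho * (x - k)%:~R - gfun (k%:~R * a 0 s).

(* The base value of the iterated maximum is the term [x = 0], so that this is
   the maximum over [0 <= x <= mu_s]. *)
Definition zeta (delta : R) : R :=
  \big[Num.max/zeta_obj delta 0]_(x < (absz (mu 0 s)).+1) zeta_obj delta x%:Z.

Definition S1plus : {set 'I_n} :=
  [set i in S1 | (mu 0 s - k + 1)%:~R * a 0 s <= a 0 i].

(* [js] is an enumeration j_1, ..., j_d of [S1plus] with nonincreasing [a];
   it is indexed from 0 in the code: [jth i] is j_(i+1). *)
Definition S1plus_enum (js : seq 'I_n) : Prop :=
  [/\ uniq js, js =i S1plus & sorted (fun i j => a 0 j <= a 0 i) js].

Variable js : seq 'I_n.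

Definition jth (i : nat) : 'I_n := nth s js i.

(* A_(i+1,q) *)
Definition Apt (i : nat) (q : int) : R :=
  \sum_(t < i) (mu 0 (jth t))%:~R * a 0 (jth t) + q%:~R * a 0 (jth i).

Definition Astar : R :=
  \sum_(t < size js) (mu 0 (jth t))%:~R * a 0 (jth t).

Definition zeta_sum (i : nat) : R :=
  \sum_(t < i) (mu 0 (jth t))%:~R * zeta (- a 0 (jth t)).

Definition phiU_piece1 (delta y : R) (i : nat) (q : int) : Prop :=
  [/\ (i < size js)%N, 1 <= q <= mu 0 (jth i),
      Apt i (q - 1) <= delta < Apt i q + (k - mu 0 s - 1)%:~R * a 0 s
    & y = gfun (delta + (mu 0 s)%:~R * a 0 s - Apt i q)
          - zeta_sum i - q%:~R * zeta (- a 0 (jth i))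
          + (k - mu 0 s)%:~R * rho - gfun (k%:~R * a 0 s)].

Definition phiU_piece2 (delta y : R) (i : nat) (q l : int) : Prop :=
  [/\ (i < size js)%N, 1 <= q <= mu 0 (jth i), 0 <= l <= mu 0 s - k,
      Apt i q + (k - mu 0 s + l - 1)%:~R * a 0 s <= delta
        < Apt i q + (k - mu 0 s + l)%:~R * a 0 s
    & y = gfun (delta + (mu 0 s - l)%:~R * a 0 s - Apt i q)
          - zeta_sum i - q%:~R * zeta (- a 0 (jth i))
          + (k - mu 0 s + l)%:~R * rho - gfun (k%:~R * a 0 s)].

Definition phiU_piece3 (delta y : R) (l : int) : Prop :=
  [/\ mu 0 s - k + 1 <= l,
      Astar + (k - mu 0 s + l - 1)%:~R * a 0 s <= delta
        < Astar + (k - mu 0 s + l)%:~R * a 0 s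
    & y = gfun (delta + (mu 0 s - l)%:~R * a 0 s - Astar)
          - zeta_sum (size js)
          + (k - mu 0 s + l)%:~R * rho - gfun (k%:~R * a 0 s)].

Definition phiU_graph (delta y : R) : Prop :=
  [\/ exists i q, phiU_piece1 delta y i q,
      exists i q l, phiU_piece2 delta y i q l
    | exists l, phiU_piece3 delta y l].

(* When [0 < a_s], [1 <= k <= mu_s], [1 <= mu_i] for all [i] and [js]
   enumerates [S1plus], the pieces are pairwise disjoint and cover [0, +oo[,
   so this is the function they define there; only [delta >= 0] matters. *)
Definition phiU (delta : R) : R := xget 0 [set y | phiU_graph delta y].

End Lifting.

(* Main.v *)
Require Import Defs.
From mathcomp Require Import all_boot all_order all_algebra.
From mathcomp Require Import all_classical all_reals all_analysis.
From mathcomp Require Import ring lra zify.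

Set Implicit Arguments.
Unset Strict Implicit.
Unset Printing Implicit Defensive.

Import Order.TTheory GRing.Theory Num.Theory.

Local Open Scope classical_set_scope.
Local Open Scope ring_scope.

(** Subtracting from [g] its chord over [[(k-1) a_s, k a_s]] and moving the
    origin turns the problem into one about a concave [G] with [G 0 = 0] and
    [G b = 0], where [b = a_s]. Up to the same linear term, [zeta (- t)] becomes
    [H t], the maximum of [G (beta - t - b j)] over the naturals [j], with
    [beta = (mu_s - k + 1) b]; it is periodic for [t <= beta] and equal to
    [G (beta - t)] beyond. Everything rests on two properties of [H]: it is
    subadditive on the half-lines [t <= beta] and [0 <= t], and it satisfies
    [H (t - d1 - d2) + H t <= H (t - d1) + H (t - d2)] for [beta <= t].

    The function [phi^U] becomes the recursion [lift_seq] along the list [L] of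
    the [a_j], [j] in [S_1^+], repeated [mu_j] times in decreasing order: an
    element [c] is subtracted from the argument as long as the latter is
    nonnegative, at the price [- H c]. Induction on [L] shows that
    prepending a larger element increases the function, that the function is
    subadditive on the nonnegative reals, and that it dominates the gain of any
    sublist of [L]; validity follows. Below [A_* + k a_s] the maximum defining
    [H] is attained with [0 <= x_s <= mu_s], which gives a tight point for each
    variable; with the point [x_s = k] these form a triangular, hence affinely
    independent, family of [n + 1] points. *)

(** * Concavity as a chord inequality free of division *)

Definition above_chords (R : numDomainType) (F : R -> R) : Prop :=
  forall p x q : R, p <= x -> x <= q ->
    (q - x) * F p + (x - p) * F q <= (q - p) * F x.

Lemma concave_above_chords (R : realType) (F : R -> R) :
  concave F -> above_chords F.
Proof.
move=> cF p x q px xq.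
have [pq|pq] := eqVneq p q.
  by rewrite -pq in xq *; rewrite (_ : x = p) ?subrr ?mul0r ?addr0//; lra.
have pq0 : 0 < q - p by rewrite subr_gt0 lt_neqAle pq (le_trans px xq).
pose t := (q - x) / (q - p).
have t0 : 0 <= t by rewrite divr_ge0; lra.
have t1 : t <= 1 by rewrite ler_pdivrMr ?mul1r; lra.
have xE : x = t * p + (1 - t) * q by rewrite /t; field; lra.
have : t * F p + (1 - t) * F q <= F x.
  have := cF (Itv01 t0 t1) p q; rewrite !inE => /(_ I I).
  (* The abstract convex combination is unfolded into real arithmetic. *)
  change (- F (t * p + (1 - t) * q) <= t * - F p + (1 - t) * - F q ->
    F x >= t * F p + (1 - t) * F q) => h.
  by move: h; rewrite -xE; lra.
rewrite -(ler_pM2l pq0); have -> : (q - p) * (t * F p + (1 - t) * F q)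
  = (q - x) * F p + (x - p) * F q by rewrite /t; field; lra.
by [].
Qed.

(** * A concave function maximised over shifts by multiples of [b] *)

Section Periodization.
Variables (R : realType) (G : R -> R) (b : R).
Hypotheses (G_chords : above_chords G) (b_gt0 : 0 < b).
Hypotheses (G_0 : G 0 = 0) (G_b : G b = 0).

Implicit Types p q x y u v e t d : R.

(** Both [x] and [y] lie between [p] and [q], and their distances to [p] add up to [q - p], so the
    two chord inequalities sum to the claim multiplied by [q - p]. The cases [x = p] and [y = p]
    come first to make this factor positive. *)
Lemma above_chords_swap p x y q :
  p <= x -> p <= y -> p + q = x + y -> G p + G q <= G x + G y.
Proof.
move=> px py e; have -> : q = x + y - p by lra.
have [->|xp] := eqVneq x p; first by rewrite addrAC subrr add0r.
have [->|yp] := eqVneq y p; first by rewrite addrK addrC.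
have qp : 0 < x + y - p - p.
  have : p < x by rewrite lt_neqAle eq_sym xp.
  by lra.
have hx : x <= x + y - p by lra.
have hy : y <= x + y - p by lra.
by rewrite -(ler_pM2l qp); have := G_chords px hx; have := G_chords py hy; lra.
Qed.

Lemma concave_ge0_in x : 0 <= x -> x <= b -> 0 <= G x.
Proof.
move=> x0 xb; have := G_chords x0 xb.
by rewrite G_0 G_b !mulr0 addr0 subr0 pmulr_rge0.
Qed.

Lemma concave_le0_left x : x <= 0 -> G x <= 0.
Proof.
move=> x0; have := G_chords x0 (ltW b_gt0).
by rewrite G_0 G_b !mulr0 addr0 subr0 pmulr_rle0.
Qed.

Lemma concave_le0_right x : b <= x -> G x <= 0.
Proof.
move=> bx; have := G_chords (ltW b_gt0) bx.
by rewrite G_0 G_b !mulr0 add0r subr0 pmulr_rle0.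
Qed.

Lemma concave_homo_left u v : u <= v -> v <= 0 -> G u <= G v.
Proof.
have b0 := b_gt0; move=> uv v0; have vb : v <= b by lra.
have bu : 0 < b - u by lra.
rewrite -(ler_pM2l bu).
(* The chord from [u] to [b] gives [(b - v) * G u <= (b - u) * G v]; since [G u <= 0], the factor
   [b - v] may be raised to [b - u]. *)
have := G_chords uv vb; rewrite G_b mulr0 addr0.
have := concave_le0_left (le_trans uv v0).
nra.
Qed.

(* [truncn] is 0 on negative numbers, so this is the maximum of [G (e - b j)]
   over the naturals [j]: periodic for [0 <= e], equal to [G] for [e <= b]. *)
Definition periodize (e : R) : R := G (e - b * (Num.truncn (e / b))%:R).

Lemma periodizeE j e :
  b * j%:R <= e -> e < b * j.+1%:R -> periodize e = G (e - b * j%:R).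
Proof.
move=> h1 h2; rewrite /periodize (@truncn_def _ _ j)//.
by rewrite ler_pdivlMr// ltr_pdivrMr// mulrC h1 mulrC.
Qed.

Lemma periodize_neg e : e <= 0 -> periodize e = G e.
Proof.
have b0 := b_gt0; rewrite le_eqVlt => /predU1P[->|e0].
  by rewrite (@periodizeE 0) ?mulr0 ?mulr1 ?subr0.
rewrite /periodize (truncn0Pn _ _) ?mulr0 ?subr0// -ltNge.
by rewrite ltr_pdivrMr//; lra.
Qed.

Lemma periodizeP e : 0 <= e -> exists j : nat,
  [/\ b * j%:R <= e, e < b * j.+1%:R & periodize e = G (e - b * j%:R)].
Proof.
move=> e0; have /truncn_itv/andP[h1 h2] : 0 <= e / b by rewrite divr_ge0// ltW.
move: h1 h2; rewrite ler_pdivlMr// ltr_pdivrMr// ![_ * b]mulrC => h1 h2.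
by eexists; split; [exact: h1 | exact: h2 | ].
Qed.

Lemma periodize_ge0 e : 0 <= e -> 0 <= periodize e.
Proof.
move=> /periodizeP[j [h1 h2 ->]]; rewrite -natr1 in h2.
by apply: concave_ge0_in; lra.
Qed.

Lemma periodize_le0 e : e <= 0 -> periodize e <= 0.
Proof. by move=> e0; rewrite periodize_neg// concave_le0_left. Qed.

(** For [0 < e], a shift other than the chosen one moves the argument outside the open interval from
    0 to [b], where [G] is nonpositive, while [periodize e] is nonnegative. For [e <= 0], [G] is
    nondecreasing to the left of 0. *)
Lemma periodize_ge j e : G (e - b * j%:R) <= periodize e.
Proof.
have bj : 0 <= b * j%:R by rewrite mulr_ge0 // ltW.
have [e0|e0] := leP e 0.
  by rewrite periodize_neg// concave_homo_left//; lra.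
have [i [h1 h2 E]] := periodizeP (ltW e0).
have [ij|ij|ij] := ltngtP i j; last by rewrite E ij.
- apply: le_trans (periodize_ge0 (ltW e0)); apply: concave_le0_left.
  have : b * i.+1%:R <= b * j%:R by rewrite ler_pM2l// ler_nat.
  by lra.
- apply: le_trans (periodize_ge0 (ltW e0)); apply: concave_le0_right.
  have : b * j.+1%:R <= b * i%:R by rewrite ler_pM2l// ler_nat.
  by rewrite -natr1; lra.
Qed.

(** When the argument on the left is positive, the residues of [e1] and [e2] modulo [b] add up
    either to its residue or to that residue plus [b]. The exchange inequality is applied with the
    endpoint 0 in the first case and [b] in the second; [G] vanishes at both. *)
Lemma periodize_subadd m e1 e2 : 0 <= e1 -> 0 <= e2 ->
  periodize (e1 + e2 - b * m%:R) <= periodize e1 + periodize e2.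
Proof.
move=> e1_0 e2_0.
have [v0|/ltW v0] := leP (e1 + e2 - b * m%:R) 0.
  apply: le_trans (periodize_le0 v0) _.
  by rewrite addr_ge0// periodize_ge0.
have [j1 [a1 b1 ->]] := periodizeP e1_0.
have [j2 [a2 b2 ->]] := periodizeP e2_0.
have [j [a3 b3 ->]] := periodizeP v0.
rewrite -natr1 in b1; rewrite -natr1 in b2; rewrite -natr1 in b3.
have h1 : (m + j < j1 + j2 + 2)%N.
  by rewrite -(ltr_nat R) -(ltr_pM2l b_gt0) !natrD; lra.
have h2 : (j1 + j2 < m + j + 1)%N.
  by rewrite -(ltr_nat R) -(ltr_pM2l b_gt0) !natrD; lra.
have [E|E] : (j1 + j2 = m + j \/ j1 + j2 + 1 = m + j)%N by lia.
  have /(congr1 ( *%R b)) : (j1 + j2)%:R = (m + j)%:R :> R by rewrite E.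
  rewrite !natrD => E'.
  have := @above_chords_swap 0 (e1 - b * j1%:R) (e2 - b * j2%:R)
     (e1 + e2 - b * m%:R - b * j%:R).
  by rewrite G_0 !add0r; apply; lra.
have /(congr1 ( *%R b)) : (j1 + j2 + 1)%:R = (m + j)%:R :> R by rewrite E.
rewrite !natrD => E'.
have := @above_chords_swap (e1 + e2 - b * m%:R - b * j%:R)
   (e1 - b * j1%:R) (e2 - b * j2%:R) b.
by rewrite G_b addr0; apply; lra.
Qed.

Lemma periodize_increment e d1 d2 : e <= 0 -> 0 <= d1 -> 0 <= d2 ->
  periodize e + periodize (e + d1 + d2)
    <= periodize (e + d1) + periodize (e + d2).
Proof.
have b0 := b_gt0; move=> e0 d1_0 d2_0; rewrite (periodize_neg e0).
have [n1 [a1 b1 _]] := periodizeP d1_0.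
have [n2 [a2 b2 _]] := periodizeP d2_0.
(* [j] is the shift used at [e + d1 + d2]; it is 0 when that point is not positive. *)
have [j [E Ej]] : exists j : nat,
    periodize (e + d1 + d2) = G (e + d1 + d2 - b * j%:R) /\
    (j = 0%N \/ b * j%:R <= e + d1 + d2).
  have [v0|/ltW/periodizeP[j [c1 c2 E]]] := leP (e + d1 + d2) 0.
    by exists 0%N; rewrite periodize_neg// mulr0 subr0; split; [|left].
  by exists j; split=> //; right.
rewrite E; rewrite -natr1 in b1; rewrite -natr1 in b2.
have [jn|jn] := leqP j (n1 + n2).
  (* The shift is shared between the two terms on the right, at most [n1] and [n2] each, so that
     both shifted arguments stay above [e]. *)
  have [j1 [j2 [jE l1 l2]]] :
      exists j1 j2, [/\ j = j1 + j2, j1 <= n1 & j2 <= n2]%N.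
    by exists (minn j n1), (j - minn j n1)%N; split; lia.
  apply: le_trans (lerD (periodize_ge j1 _) (periodize_ge j2 _)).
  have k1 : b * j1%:R <= b * n1%:R by rewrite ler_pM2l// ler_nat.
  have k2 : b * j2%:R <= b * n2%:R by rewrite ler_pM2l// ler_nat.
  by apply: above_chords_swap; rewrite ?jE ?natrD; lra.
(* Here exactly one shift is left over. Then [e + b] lies between 0 and [b], and it replaces [e] in
   the exchange because [G e <= 0 <= G (e + b)]. *)
case: Ej => [j0|Ej]; first by lia.
have jE : j = (n1 + n2 + 1)%N.
  suff : (j < n1 + n2 + 2)%N by lia.
  by rewrite -(ltr_nat R) -(ltr_pM2l b_gt0) !natrD; lra.
rewrite jE !natrD in Ej *.
have e_le0 := concave_le0_left e0.
have eb_ge0 : 0 <= G (e + b) by apply: concave_ge0_in; lra.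
apply: le_trans (lerD (periodize_ge n1 _) (periodize_ge n2 _)).
have : G (e + d1 + d2 - b * (n1%:R + n2%:R + 1)) + G (e + b)
     <= G (e + d1 - b * n1%:R) + G (e + d2 - b * n2%:R).
  by apply: above_chords_swap; lra.
lra.
Qed.

Variable m : nat.

(** The function [H] of the overview, with [m] standing for [mu_s - k + 1]. *)
Definition periodize_tail (t : R) : R := periodize (b * m%:R - t).

Local Notation H := periodize_tail.
Local Notation beta := (b * m%:R).

Lemma periodize_tail0 : H 0 = 0.
Proof.
rewrite /H subr0 (@periodizeE m) ?subrr//.
by rewrite ltr_pM2l// ltr_nat.
Qed.

Lemma periodize_tail_subadd_le t1 t2 :
  t1 <= beta -> t2 <= beta -> H (t1 + t2) <= H t1 + H t2.
Proof.
move=> h1 h2; rewrite /H.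
have -> : beta - (t1 + t2) = (beta - t1) + (beta - t2) - beta by ring.
by apply: periodize_subadd; lra.
Qed.

(** Let [t1] be the larger argument. If it exceeds [beta], then [H] is [G (beta - t)] both there and
    at the sum. A [t2] below [beta] contributes [0 <= H t2], and monotonicity of [G] on the left
    suffices; otherwise an exchange with the endpoint 0 is followed by monotonicity. *)
Lemma periodize_tail_subadd_ge0 t1 t2 :
  0 <= t1 -> 0 <= t2 -> H (t1 + t2) <= H t1 + H t2.
Proof.
have mb : 0 <= beta by rewrite mulr_ge0// ltW.
wlog : t1 t2 / t2 <= t1 => [hw h1 h2|h12 h1 h2].
  have [/hw|/ltW /hw] := leP t2 t1; first exact.
  by rewrite addrC [H t1 + _]addrC; apply.
have [h3|/ltW h3] := leP t1 beta.
  by apply: periodize_tail_subadd_le; lra.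
rewrite /H [periodize (_ - (_ + _))]periodize_neg; last by lra.
rewrite [periodize (_ - t1)]periodize_neg; last by lra.
have [h4|/ltW h4] := leP t2 beta.
  have : 0 <= periodize (beta - t2) by apply: periodize_ge0; lra.
  have : G (beta - (t1 + t2)) <= G (beta - t1).
    by apply: concave_homo_left; lra.
  lra.
rewrite periodize_neg; last by lra.
have : G (beta - t1 + (beta - t2)) + G 0 <= G (beta - t1) + G (beta - t2).
  by apply: above_chords_swap; lra.
rewrite G_0 addr0.
have : G (beta - (t1 + t2)) <= G (beta - t1 + (beta - t2)).
  by apply: concave_homo_left; lra.
lra.
Qed.

Lemma periodize_tail_increment t d1 d2 : beta <= t -> 0 <= d1 -> 0 <= d2 ->
  H (t - d1 - d2) + H t <= H (t - d1) + H (t - d2).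
Proof.
move=> h h1 h2; rewrite /H.
have h0 : beta - t <= 0 by lra.
have := periodize_increment h0 h1 h2.
have -> : beta - t + d1 + d2 = beta - (t - d1 - d2) by ring.
have -> : beta - t + d1 = beta - (t - d1) by ring.
have -> : beta - t + d2 = beta - (t - d2) by ring.
lra.
Qed.

End Periodization.

(** * The recursion [lift_seq] for an abstract [H] *)

Section SequentialLifting.
Variables (R : realType) (H : R -> R) (beta : R).

Implicit Types (c e t d : R) (L D : seq R).

(** The element that makes the argument negative is still paid for; it is the [q]-th copy in the
    pieces (1) and (2) of phi^U. *)
Fixpoint lift_seq (L : seq R) (d : R) : R :=
  if d < 0 then H (- d) else
  if L is c :: L' then lift_seq L' (d - c) - H c else H (- d).

Lemma lift_seq_neg L d : d < 0 -> lift_seq L d = H (- d).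
Proof. by case: L => [|c L] /= ->. Qed.

Lemma lift_seq_nil d : lift_seq [::] d = H (- d).
Proof. by rewrite /= if_same. Qed.

Lemma lift_seq_cons c L d : 0 <= d ->
  lift_seq (c :: L) d = lift_seq L (d - c) - H c.
Proof. by rewrite /= leNgt => /negbTE ->. Qed.

Lemma lift_seq_cat L1 L2 d : all (>= 0) L1 -> \sum_(c <- L1) c <= d ->
  lift_seq (L1 ++ L2) d = lift_seq L2 (d - \sum_(c <- L1) c) - \sum_(c <- L1) H c.
Proof.
elim: L1 d => [|c L1 IH] d; first by rewrite !big_nil !subr0.
move=> /andP[c0 L0]; rewrite !big_cons => h.
have s0 : 0 <= \sum_(c <- L1) c by rewrite big_seq sumr_ge0// => i /(allP L0).
rewrite cat_cons lift_seq_cons ?IH//; last 2 first.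
- by lra.
- by lra.
by rewrite !opprD !addrA; ring.
Qed.

Hypotheses (beta_ge0 : 0 <= beta) (H_0 : H 0 = 0).

Lemma lift_seq0 L : all (>= 0) L -> lift_seq L 0 = 0.
Proof.
elim: L => [|c L IH]; first by rewrite lift_seq_nil oppr0.
move=> /andP[c0 L0]; rewrite lift_seq_cons// sub0r.
move: c0; rewrite /= le_eqVlt => /predU1P[<-|c0].
  by rewrite oppr0 IH// H_0 subrr.
by rewrite lift_seq_neg ?oppr_lt0// opprK subrr.
Qed.

Hypothesis H_le : forall t1 t2 : R,
  t1 <= beta -> t2 <= beta -> H (t1 + t2) <= H t1 + H t2.
Hypothesis H_ge0 : forall t1 t2 : R,
  0 <= t1 -> 0 <= t2 -> H (t1 + t2) <= H t1 + H t2.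
Hypothesis H_increment : forall t d1 d2 : R, beta <= t -> 0 <= d1 -> 0 <= d2 ->
  H (t - d1 - d2) + H t <= H (t - d1) + H (t - d2).

(** Induction on [L]. The empty list is the increment property at [c]. For a head [e]: if [c <= d],
    both sides subtract [e]; if [d < e], the increment property with steps [d] and [c - e] applies;
    if [e <= d < c], the induction hypothesis leaves [H (c - d + e)], which subadditivity splits. *)
Lemma lift_seq_shift c L d : beta <= c -> all (<= c) L -> all (>= beta) L ->
  0 <= d -> lift_seq L d <= lift_seq L (d - c) - H c.
Proof.
move=> bc; elim: L d => [|e L IH] d /=.
  move=> _ _ d0; rewrite !if_same.
  have := H_increment bc d0 (le_trans beta_ge0 bc).
  rewrite subrr H_0 (_ : c - d - c = - d); last by ring.
  by rewrite opprB; lra.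
move=> /andP[ec Lc] /andP[be bL] d0.
rewrite ltNge d0 /=; have [dc|dc] := ltP (d - c) 0; last first.
  have := IH (d - e) Lc bL; have -> : d - e - c = d - c - e by ring.
  have h : 0 <= d - e by lra.
  by move=> /(_ h); lra.
have e0 := le_trans beta_ge0 be; rewrite opprB; have [de|de] := ltP (d - e) 0.
  rewrite lift_seq_neg// opprB.
  have ce : 0 <= c - e by lra.
  have := H_increment bc d0 ce.
  have -> : c - d - (c - e) = e - d by ring.
  have -> : c - (c - e) = e by ring.
  by lra.
have := IH (d - e) Lc bL de; rewrite [X in _ <= X - _]lift_seq_neg; last by lra.
have -> : - (d - e - c) = (c - d) + e by ring.
have cd : 0 <= c - d by lra.
have := H_ge0 cd e0.
lra.
Qed.

Lemma lift_seq_cons_ge c L d : beta <= c -> all (<= c) L -> all (>= beta) L ->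
  lift_seq L d <= lift_seq (c :: L) d.
Proof.
move=> bc Lc bL; have [d0|d0] := ltP d 0; first by rewrite !lift_seq_neg.
by rewrite lift_seq_cons// lift_seq_shift.
Qed.

Lemma sorted_cons_all (c : R) L : sorted >=%R (c :: L) ->
  all (<= c) L /\ sorted >=%R L.
Proof.
move=> cL; split; last exact: path_sorted cL.
exact: (order_path_min (rev_trans le_trans) cL).
Qed.

(** Induction on [L] with [d1] the larger argument. If [c <= d1], the head [c] is removed from the
    sum and from [d1], and put back in front for [d2]. If both arguments are below [c], each
    right-hand term stops after one step; the left one either stops too, or is shifted by [c] once
    more so that it stops. *)
Lemma lift_seq_subadd L d1 d2 : sorted >=%R L -> all (>= beta) L ->
  0 <= d1 -> 0 <= d2 -> lift_seq L (d1 + d2) <= lift_seq L d1 + lift_seq L d2.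
Proof.
have b0 := beta_ge0; elim: L d1 d2 => [|c L IH] d1 d2.
  by move=> _ _ h1 h2; rewrite !lift_seq_nil opprD H_le//; lra.
move=> /sorted_cons_all[Lc Ls] bcL.
have /andP[bc bL] := bcL.
wlog : d1 d2 / d2 <= d1 => [hw h1 h2|h12 h1 h2].
  have [/hw|/ltW /hw] := leP d2 d1; first exact.
  by rewrite addrC [lift_seq _ d1 + _]addrC; apply.
have h3 : 0 <= d1 + d2 by lra.
have [d1c|d1c] := leP c d1.
  rewrite [lift_seq _ (d1 + d2)]lift_seq_cons// [lift_seq _ d1]lift_seq_cons//.
  have := IH (d1 - c) d2 Ls bL; have -> : d1 - c + d2 = d1 + d2 - c by ring.
  have h : 0 <= d1 - c by lra.
  move=> /(_ h h2).
  have := lift_seq_cons_ge d2 bc Lc bL.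
  by lra.
rewrite !lift_seq_cons// [lift_seq L (d1 - c)]lift_seq_neg; last by lra.
rewrite [lift_seq L (d2 - c)]lift_seq_neg; last by lra.
rewrite !opprB.
have [d12|d12] := ltP (d1 + d2 - c) 0.
  rewrite lift_seq_neg// opprB.
  have := H_increment bc h1 h2.
  have -> : c - d1 - d2 = c - (d1 + d2) by ring.
  lra.
have := lift_seq_shift bc Lc bL d12.
rewrite [X in _ <= X - _]lift_seq_neg; last by lra.
have -> : - (d1 + d2 - c - c) = (c - d1) + (c - d2) by ring.
have k1 : 0 <= c - d1 by lra.
have k2 : 0 <= c - d2 by lra.
have := H_ge0 k1 k2.
lra.
Qed.

(** Each missing element is prepended to a tail of [L], whose elements it dominates. *)
Lemma lift_seq_subseq D L d : subseq D L -> sorted >=%R L ->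
  all (>= beta) L -> lift_seq D d <= lift_seq L d.
Proof.
elim: L D d => [|c L IH] [|e D] d //.
  move=> _ /sorted_cons_all[Lc Ls] /andP[bc bL].
  by apply: le_trans (lift_seq_cons_ge _ bc Lc bL); apply: IH; rewrite ?sub0seq.
move=> /= + /sorted_cons_all[Lc Ls] /andP[bc bL].
case: eqP => [->|_] DL.
  by case: ifP => // _; rewrite lerB// IH.
by apply: le_trans (lift_seq_cons_ge _ bc Lc bL); exact: (IH (e :: D)).
Qed.

(** As long as [d] is nonnegative, one step of the recursion removes the head from both sides. Once
    it is negative, the claim is subadditivity of [H] over the remaining elements and [- d]. *)
Lemma lift_seq_ge_all L d : all (>= 0) L ->
  H (\sum_(c <- L) c - d) - \sum_(c <- L) H c <= lift_seq L d.
Proof.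
have Hneg D e : all (>= 0) D -> 0 <= e ->
    H (\sum_(c <- D) c + e) <= \sum_(c <- D) H c + H e.
  elim: D e => [|c D IH] e /=; first by rewrite !big_nil !add0r.
  move=> /andP[c0 D0] e0; rewrite !big_cons -!addrA.
  have s0 : 0 <= \sum_(c <- D) c by rewrite big_seq sumr_ge0// => i /(allP D0).
  have se : 0 <= \sum_(c <- D) c + e by lra.
  by apply: le_trans (H_ge0 c0 se) _; rewrite lerD2l IH.
elim: L d => [|c L IH] d L0; first by rewrite lift_seq_nil !big_nil subr0 add0r.
have [d0|d0] := ltP d 0.
  by rewrite lift_seq_neg//; have := @Hneg (c :: L) (- d) L0; lra.
rewrite lift_seq_cons// !big_cons.
have /andP[c0 /(IH (d - c))] := L0.
have -> : \sum_(c <- L) c - (d - c) = c + \sum_(c <- L) c - d by ring.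
lra.
Qed.

Lemma lift_seq_ge_subseq D L d : subseq D L -> sorted >=%R L ->
  all (>= beta) L -> H (\sum_(c <- D) c - d) - \sum_(c <- D) H c <= lift_seq L d.
Proof.
move=> DL sL bL; apply: le_trans (lift_seq_subseq _ DL sL bL).
apply: lift_seq_ge_all; apply/allP => c /(mem_subseq DL) /(allP bL).
exact: le_trans.
Qed.

End SequentialLifting.

(** * Bounds on the affine dimension *)

Section AffineDimension.
Variables (R : realType) (V : vectType R).
Implicit Type P : set V.

Lemma aff_dim_ge P m (t : 'I_m -> V) : (m <= (\dim {:V}).+1)%N ->
  aff_indep t -> (forall i, P (t i)) -> m%:Z - 1 <= aff_dim P.
Proof.
move=> mV t_indep tP; rewrite /aff_dim lerD2r lez_nat.
apply: (@leq_bigmax_cond _ _ (fun i : 'I_(\dim {:V}).+2 => i : nat)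
  (Ordinal (mV : (m < (\dim {:V}).+2)%N))).
by apply/asboolP; exists t.
Qed.

Lemma aff_dim_le P m :
  (forall m' (t : 'I_m' -> V), (m' <= (\dim {:V}).+1)%N -> aff_indep t ->
     (forall i, P (t i)) -> (m' <= m)%N) ->
  aff_dim P <= m%:Z - 1.
Proof.
move=> h; rewrite /aff_dim lerD2r lez_nat; apply/bigmax_leqP => i /asboolP[t [ti tP]].
by apply: h ti tP; rewrite -ltnS.
Qed.

End AffineDimension.

(** * A facet criterion for the hull of points below an affine graph *)

Section Facet.
Variables (R : realType) (n : nat).
Local Notation V := (R^o * 'rV[R]_n)%type.
Implicit Types (p : V) (X : set V).

Lemma dim_graph_space : \dim {:V} = n.+1.
Proof. by rewrite dimvf -[n in RHS]mul1n. Qed.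

Lemma sum_pair m (F : 'I_m -> V) :
  \sum_i F i = (\sum_i (F i).1, \sum_i (F i).2).
Proof.
elim/big_rec3: _ => [|i x y z _ ->]; last by case: (F i).
by [].
Qed.

Variables (alpha : 'cV[R]_n) (c0 : R).

(** The linear functional whose level set at [c0] is the hyperplane of equality. *)
Definition graph_gap p : R := p.1 - (p.2 *m alpha) 0 0.

Lemma graph_gap_sum m (c : 'I_m -> R) (t : 'I_m -> V) :
  graph_gap (\sum_i c i *: t i) = \sum_i c i * graph_gap (t i).
Proof.
rewrite /graph_gap sum_pair /= mulmx_suml summxE -sumrB.
by apply: eq_bigr => i _; rewrite -scalemxAl mxE mulrBr.
Qed.

(** On a level set of [graph_gap] the second component determines the first. Hence a linear
    dependence among the rows [(1, x)] in dimension [n + 1] is already an affine dependence among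
    the points. *)
Lemma aff_indep_graph_size m (t : 'I_m -> V) :
  aff_indep t -> (forall i, graph_gap (t i) = c0) -> (m <= n.+1)%N.
Proof.
move=> ti tc; rewrite leqNgt; apply/negP => mn.
pose A : 'M[R]_(m, 1 + n) := \matrix_(i < m) (row_mx (1%:M : 'M[R]_1) (snd (t i))).
have : ~~ row_free A.
  by rewrite /row_free neq_ltn (leq_ltn_trans (rank_leq_col _)).
rewrite -kermx_eq0 => /rowV0Pn[v /sub_kermxP vA v0].
have vE : v *m A = \sum_i row_mx ((v 0 i)%:M : 'M[R]_1) (v 0 i *: (t i).2).
  rewrite mulmx_sum_row; apply: eq_bigr => i _.
  by rewrite rowK scale_row_mx scalemx1.
have s0 : \sum_i v 0 i = 0.
  have := congr1 (fun w : 'rV_(1 + n) => w 0 (lshift n 0)) vE.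
  rewrite vA mxE summxE => {2}->; apply: eq_bigr => i _.
  by rewrite row_mxEl mxE eqxx mulr1n.
have s2 : \sum_i v 0 i *: (t i).2 = 0.
  apply/rowP => j.
  have := congr1 (fun w : 'rV_(1 + n) => w 0 (rshift 1 j)) vE.
  rewrite vA !mxE !summxE => {2}->; apply: eq_bigr => i _.
  by rewrite row_mxEr.
have /ti h : \sum_i v 0 i = 0 by [].
case/eqP: v0; apply/rowP => j; rewrite mxE; apply: h.
(* All gaps equal [c0] and the coefficients sum to 0, so the first component of the combination
   vanishes as well. *)
have := graph_gap_sum (fun i => v 0 i) t.
under [X in _ = X]eq_bigr => i _ do rewrite tc.
rewrite -mulr_suml s0 mul0r /graph_gap sum_pair /= s2 mul0mx mxE subr0 => ->.
by [].
Qed.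

(** Applying [graph_gap] to a dependence leaves the coefficient of [p] times [graph_gap p - c0], so
    that coefficient is 0. *)
Lemma aff_indep_cons m (t : 'I_m -> V) p :
  aff_indep t -> (forall i, graph_gap (t i) = c0) -> graph_gap p <> c0 ->
  aff_indep (fun i => if unlift ord0 i is Some j then t j else p).
Proof.
move=> ti tc pc c; rewrite !big_ord_recl unlift_none.
move=> s0; under [X in _ + X]eq_bigr => i _ do rewrite liftK.
move=> s1.
have h0 : c ord0 = 0.
  have := graph_gap_sum c (fun i => if unlift ord0 i is Some j then t j else p).
  rewrite !big_ord_recl unlift_none.
  under [X in graph_gap (_ + X)]eq_bigr => i _ do rewrite liftK.
  under [X in _ = _ + X]eq_bigr => i _ do rewrite liftK tc.
  rewrite s1 -mulr_suml /graph_gap /= mul0mx mxE subr0 -/(graph_gap p).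
  have -> : \sum_i c (lift ord0 i) = - c ord0 by apply/eqP; rewrite -addr_eq0 addrC s0.
  rewrite mulNr -mulrBr => /esym/eqP; rewrite mulf_eq0 subr_eq0.
  by case/orP => /eqP.
move: s0 s1; rewrite h0 scale0r !add0r => s0 s1 i.
have [j ->|->//] := unliftP ord0 i.
exact: (ti (fun j => c (lift ord0 j))).
Qed.

Variable rhs : V -> R.
Hypothesis rhsE : forall p, rhs p = (p.2 *m alpha) 0 0 + c0.
Local Notation lhs := (fun p : V => p.1 : R).

Let gap_eq p : (graph_gap p = c0) <-> (lhs p = rhs p).
Proof.
rewrite rhsE /graph_gap; split => [<-|->]; first by rewrite addrC subrK.
by rewrite addrAC subrr add0r.
Qed.

Lemma valid_ineq_conv_hull X :
  valid_ineq lhs rhs X -> valid_ineq lhs rhs (conv_hull X).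
Proof.
move=> hX; apply: smallest_sub hX => x y l; rewrite !inE.
change (lhs x <= rhs x -> lhs y <= rhs y ->
  l%:num * lhs x + (1 - l%:num) * lhs y <= rhs (l%:num *: x + (1 - l%:num) *: y)).
rewrite !rhsE /= mulmxDl -!scalemxAl !mxE.
have l0 : 0 <= l%:num by [].
have l1 : 0 <= 1 - l%:num by rewrite subr_ge0.
move: l%:num l0 l1 => r r0 r1 hx hy.
have := ler_wpM2l r0 hx; have := ler_wpM2l r1 hy; lra.
Qed.

(** The tight points together with [p] are [n + 2] affinely independent points, so the hull has full
    dimension [n + 1]. The tight face lies in a hyperplane and contains [n + 1] such points, so its
    dimension is [n]. *)
Lemma facet_defining_conv_hull X (t : 'I_n.+1 -> V) p :
  valid_ineq lhs rhs X -> aff_indep t ->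
  (forall i, X (t i) /\ lhs (t i) = rhs (t i)) ->
  X p -> lhs p <> rhs p ->
  facet_defining lhs rhs (conv_hull X).
Proof.
move=> hX ti tX Xp prhs; rewrite /facet_defining /=.
have vH := valid_ineq_conv_hull hX.
have XH : X `<=` conv_hull X by exact: sub_gen_smallest.
have tc i : graph_gap (t i) = c0 by apply/gap_eq; case: (tX i).
have pc : graph_gap p <> c0 by move/gap_eq.
split => //.
  exists graph_gap, c0; split.
  - move=> r u v; rewrite /graph_gap /= mulmxDl -scalemxAl.
    by rewrite !mxE mulrBr opprD addrACA.
  - by move=> q /vH; rewrite rhsE /graph_gap lerBlDl.
  - by apply/seteqP; split => q /= [Hq /gap_eq].
have -> : aff_dim (conv_hull X) = n.+2%:Z - 1.
  apply/eqP; rewrite eq_le; apply/andP; split.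
    by apply: aff_dim_le => m u; rewrite dim_graph_space.
  apply: aff_dim_ge (aff_indep_cons ti tc pc) _; first by rewrite dim_graph_space.
  by move=> i; apply: XH; case: unlift => [j|//]; case: (tX j).
have -> : n.+2%:Z - 1 - 1 = n.+1%:Z - 1 by lia.
apply/eqP; rewrite eq_le; apply/andP; split.
  apply: aff_dim_le => m u _ ui uF; apply: aff_indep_graph_size ui _ => i.
  by apply/gap_eq; case: (uF i).
apply: aff_dim_ge ti _; first by rewrite dim_graph_space.
by move=> i; case: (tX i) => /XH.
Qed.

End Facet.

(** * Sums and lists with multiplicities *)

Lemma big_take_nth (V : nmodType) (T : Type) (x0 : T) (r : seq T) (F : T -> V) i :
  (i <= size r)%N ->
  \sum_(x <- take i r) F x = \sum_(t < i) F (nth x0 r t).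
Proof.
move=> ir; rewrite (big_nth x0) size_takel// big_mkord.
by apply: eq_bigr => t _; rewrite nth_take.
Qed.

Lemma sum_flatten_nseq (R : pzRingType) (I : Type) (T : Type) (r : seq I)
    (y : I -> nat) (c : I -> T) (F : T -> R) :
  \sum_(x <- flatten [seq nseq (y j) (c j) | j <- r]) F x
    = \sum_(j <- r) (y j)%:R * F (c j).
Proof.
rewrite big_flatten big_map; apply: eq_bigr => j _.
by rewrite big_nseq iter_addr_0 mulr_natl.
Qed.

Lemma natr_absz_ge0 (R : pzRingType) (x : int) :
  0 <= x -> (absz x)%:R = x%:~R :> R.
Proof. by move=> x0; rewrite pmulrn gez0_abs. Qed.

(** The copies of each [c i] are split off one at a time inside the domain [D]. This serves both for
    [H] on the elements below [beta] and for the lifting function on the nonnegative reals. *)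
Lemma subadd_sum (R : realType) (I : finType) (A : pred I) (D : pred R)
    (P : R -> R) (c : I -> R) (q : I -> nat) (t : R) :
  (forall i u, A i -> D u -> D (c i + u)) ->
  (forall i u, A i -> D u -> P (c i + u) <= P (c i) + P u) -> D t ->
  P (\sum_(i | A i) (q i)%:R * c i + t)
    <= \sum_(i | A i) (q i)%:R * P (c i) + P t.
Proof.
move=> DA PA Dt.
have step (i : I) (u : R) (m : nat) : A i -> D u ->
    D (m%:R * c i + u) /\ P (m%:R * c i + u) <= m%:R * P (c i) + P u.
  move=> Ai Du; elim: m => [|m [IH1 IH2]]; first by rewrite !mul0r !add0r.
  have -> : m.+1%:R * c i + u = c i + (m%:R * c i + u) by rewrite -natr1; ring.
  split; first exact: DA.
  by apply: le_trans (PA _ _ Ai IH1) _; rewrite -natr1; lra.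
suff : D (\sum_(i | A i) (q i)%:R * c i + t) /\
  P (\sum_(i | A i) (q i)%:R * c i + t)
    <= \sum_(i | A i) (q i)%:R * P (c i) + P t by case.
apply: (big_rec2 (fun u v => D (u + t) /\ P (u + t) <= v + P t)).
  by rewrite !add0r.
move=> i u v Ai [Du Pu]; have [h1 h2] := step i _ (q i) Ai Du.
by rewrite -!addrA; split=> //; lra.
Qed.

Lemma subseq_flatten_nseq (I : Type) (T : eqType) (r : seq I) (y z : I -> nat)
    (c : I -> T) : (forall j, y j <= z j)%N ->
  subseq (flatten [seq nseq (y j) (c j) | j <- r])
         (flatten [seq nseq (z j) (c j) | j <- r]).
Proof.
move=> yz; elim: r => //= j r IH; apply: cat_subseq => //.
by rewrite -(subnKC (yz j)) nseqD prefix_subseq.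
Qed.

Lemma sorted_flatten_nseq (I : Type) (T : Type) (le : rel T) (r : seq I)
    (z : I -> nat) (c : I -> T) : reflexive le -> transitive le ->
  sorted (fun i j => le (c i) (c j)) r ->
  sorted le (flatten [seq nseq (z j) (c j) | j <- r]).
Proof.
move=> le_refl le_trans.
have tr : transitive (fun i j => le (c i) (c j)) by move=> x y w; exact: le_trans.
rewrite !sorted_pairwise//; elim: r => //= j r IH /andP[jr /IH{}IH].
rewrite pairwise_cat IH andbT; apply/andP; split; last first.
  elim: (z j) => //= m ->; rewrite andbT.
  by rewrite all_nseq le_refl orbT.
suff h : all (le (c j)) (flatten [seq nseq (z i) (c i) | i <- r]).
  by elim: (z j) => //= m IHm; rewrite allrel_consl h.
elim: r jr {IH} => //= i r IH /andP[ji jr].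
by rewrite all_cat IH// andbT all_nseq ji orbT.
Qed.

(** * The data of the theorem in terms of [G], [H] and [lift_seq] *)

Section Coefficients.
Variables (R : realType) (n : nat) (f : R -> R).
Variables (a : 'rV[R]_n) (mu : 'rV[int]_n) (s : 'I_n) (S1 : {set 'I_n}).
Variables (k : int) (js : seq 'I_n).
Hypotheses (f_concave : concave f) (a_ge0 : forall i, 0 <= a 0 i).
Hypotheses (mu_ge1 : forall i, 1 <= mu 0 i) (as_gt0 : 0 < a 0 s).
Hypotheses (k_ge1 : 1 <= k) (k_le_mu : k <= mu 0 s).
Hypothesis js_enum : S1plus_enum a mu s S1 k js.

Implicit Types (z t d c p x q : R).

Local Notation g := (gfun f a mu S1).
Local Notation rho := (rho f a mu s S1 k).
Local Notation zeta := (zeta f a mu s S1 k).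
Local Notation b := (a 0 s).
Local Notation slope := (rho / b).
Local Notation Apt := (Apt a mu s js).
Local Notation Astar := (Astar a mu s js).

(* [g] minus its chord over [[(k-1) a_s, k a_s]], with the origin moved to
   [(k-1) a_s]. *)
Definition chord_gap z : R :=
  g ((k - 1)%:~R * b + z) - rho * (z / b - 1) - g (k%:~R * b).

Local Notation G := chord_gap.

Let b_neq0 : b != 0. Proof. by rewrite gt_eqF. Qed.

Lemma gfunE z : g z = G (z - (k - 1)%:~R * b) + rho * (z / b - k%:~R) + g (k%:~R * b).
Proof.
rewrite /G [_ + (z - _)]addrC subrK intrD; have b0 := b_neq0.
by field.
Qed.

Lemma chord_gap0 : G 0 = 0.
Proof. by rewrite /G addr0 mul0r /Defs.rho; ring. Qed.

Lemma chord_gapb : G b = 0.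
Proof.
rewrite /G divff// subrr mulr0 subr0.
by rewrite (_ : _ * b + b = k%:~R * b) ?subrr// intrD; ring.
Qed.

Lemma chord_gap_chords : above_chords G.
Proof.
move=> p x q px xq; rewrite /G /gfun.
set c := \sum_(i in S1) _; set h := (k - 1)%:~R * b.
have h1 : h + p + c <= h + x + c by lra.
have h2 : h + x + c <= h + q + c by lra.
have := concave_above_chords f_concave h1 h2.
have := b_neq0; set F1 := f (h + p + c); set F2 := f (h + q + c).
set F3 := f (h + x + c); set C := f (k%:~R * b + c); move: rho => r b0 E.
rewrite -subr_ge0.
have -> : (q - p) * (F3 - r * (x / b - 1) - C)
    - ((q - x) * (F1 - r * (p / b - 1) - C)
       + (x - p) * (F2 - r * (q / b - 1) - C))
  = (q - p) * F3 - ((q - x) * F1 + (x - p) * F2) by field.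
rewrite subr_ge0; move: E; lra.
Qed.

(** The natural number [m] of the periodization: [b * slack] is [beta]. *)
Definition slack : nat := absz (mu 0 s - k + 1).

Lemma slackE : slack%:R = (mu 0 s)%:~R - k%:~R + 1 :> R.
Proof. by rewrite natr_absz_ge0 ?intrD ?intrN//; have := k_le_mu; lia. Qed.

Definition gap_tail : R -> R := periodize_tail G b slack.

Local Notation H := gap_tail.

Definition S1plus_coefs : seq R :=
  flatten [seq nseq (absz (mu 0 j)%R) (a 0 j) | j <- js].

Definition lift_fun : R -> R := lift_seq H S1plus_coefs.

Local Notation Psi := lift_fun.

(** The value [x] of [x_s] corresponds to the shift [j = mu_s - x]. *)
Lemma gap_tail_ge (x : int) t :
  x <= mu 0 s -> G (x%:~R * b - (k - 1)%:~R * b - t) <= H t.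
Proof.
move=> xM.
have -> : x%:~R * b - (k - 1)%:~R * b - t
    = b * slack%:R - t - b * (absz (mu 0 s - x)%R)%:R.
  by rewrite slackE natr_absz_ge0 ?subr_ge0// !intrD !intrN; ring.
by apply: periodize_ge; [exact: chord_gap_chords | | exact: chord_gap0 | exact: chord_gapb].
Qed.

(** The bound on [t] keeps the optimal shift [j] at most [mu_s + 1], and [x = mu_s - j] works up to
    [mu_s]. The extreme shift occurs only at [t = - k b], where [x = 0] does as well because
    [G 0 = G b]. *)
Lemma gap_tail_attained t : - (k%:~R * b) <= t ->
  exists2 x : int, 0 <= x <= mu 0 s &
    H t = G (x%:~R * b - (k - 1)%:~R * b - t).
Proof.
move=> kt; have b0 := as_gt0; have kM := k_le_mu; have k1 := k_ge1; have ba := slackE.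
have [e0|e0] := leP (b * slack%:R - t) 0.
  exists (mu 0 s); first by lia.
  rewrite /H /periodize_tail periodize_neg//.
  by congr G; rewrite ba !intrD; ring.
have [j [h1 h2 E]] := periodizeP G as_gt0 (ltW e0).
rewrite /H /periodize_tail E.
have jM : (j%:Z <= mu 0 s + 1).
  rewrite -(ler_int R) !intrD -(ler_pM2l as_gt0) -pmulrn.
  by move: h1; rewrite ba; lra.
have [jM1|jM1] := eqVneq j%:Z (mu 0 s + 1).
  exists 0; first by lia.
  have jE : j%:R = (mu 0 s)%:~R + 1 :> R by rewrite pmulrn jM1 intrD.
  have tE : t = - (k%:~R * b) by move: h1 kt; rewrite jE ba; lra.
  rewrite jE ba tE [LHS](_ : _ = G 0); last by congr G; ring.
  rewrite chord_gap0 -chord_gapb; congr G; rewrite !intrD; ring.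
exists (mu 0 s - j%:Z); first by lia.
by congr G; rewrite ba !intrD !intrN -pmulrn; ring.
Qed.

(** Restoring the chord changes every term of the maximum by the same amount [slope * c]. *)
Lemma zetaE c : 0 <= c -> zeta (- c) = H c - slope * c.
Proof.
move=> c0; have kM := k_le_mu; have k1 := k_ge1.
have E (x : int) : zeta_obj f a mu s S1 k (- c) x
    = G (x%:~R * b - (k - 1)%:~R * b - c) - slope * c.
  rewrite /zeta_obj gfunE.
  rewrite (_ : - c + b * x%:~R - (k - 1)%:~R * b =
    x%:~R * b - (k - 1)%:~R * b - c); last by ring.
  by have b0 := b_neq0; rewrite !intrD; field.
apply/eqP; rewrite eq_le; apply/andP; split.
  apply: bigmax_le => [|x _]; rewrite E lerD2r gap_tail_ge//.
    by have := mu_ge1 s; lia.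
  by have := ltn_ord x; have := mu_ge1 s; lia.
have [x xM ->] : exists2 x : int, 0 <= x <= mu 0 s &
    H c = G (x%:~R * b - (k - 1)%:~R * b - c).
  apply: gap_tail_attained; apply: le_trans c0.
  by rewrite oppr_le0 mulr_ge0// ler0z; lia.
rewrite -E.
have xlt : (absz x < (absz (mu 0 s)%R).+1)%N by lia.
have := le_bigmax (zeta_obj f a mu s S1 k (- c) 0)
  (fun x : 'I_(absz (mu 0 s)%R).+1 => zeta_obj f a mu s S1 k (- c) x%:Z) (Ordinal xlt).
by rewrite /= gez0_abs; [exact | case/andP: xM].
Qed.

Lemma zeta_sumE i : zeta_sum f a mu s S1 k js i =
  \sum_(t < i) (mu 0 (jth s js t))%:~R * H (a 0 (jth s js t))
  - slope * \sum_(t < i) (mu 0 (jth s js t))%:~R * a 0 (jth s js t).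
Proof.
rewrite mulr_sumr -sumrB; apply: eq_bigr => t _.
by rewrite zetaE//; ring.
Qed.

(** * Agreement of the piecewise phi^U with the recursion *)

Lemma S1plus_coefs_ge0 : all (>= 0) S1plus_coefs.
Proof.
by apply/allP => c /flattenP[_ /mapP[j _ ->]] /nseqP[-> _].
Qed.

Lemma S1plus_coefs_cat i (q : nat) : (i < size js)%N -> (q.+1%:Z <= mu 0 (jth s js i)) ->
  exists L, S1plus_coefs = (flatten [seq nseq (absz (mu 0 j)%R) (a 0 j) | j <- take i js]
    ++ nseq q (a 0 (jth s js i))) ++ a 0 (jth s js i) :: L.
Proof.
move=> ijs qmu; rewrite /S1plus_coefs.
exists (nseq (absz (mu 0 (jth s js i))%R - q.+1) (a 0 (jth s js i))
  ++ flatten [seq nseq (absz (mu 0 j)%R) (a 0 j) | j <- drop i.+1 js]).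
rewrite -{1}(cat_take_drop i js) (drop_nth s)// map_cat flatten_cat /= -!catA.
congr (_ ++ _); rewrite -[a 0 _ :: _]/(nseq 1 _ ++ _) !catA; congr (_ ++ _).
by rewrite -!nseqD; congr nseq; rewrite /jth in qmu *; lia.
Qed.

(** The first [i] blocks and [q - 1] further copies are subtracted with a nonnegative remainder; the
    next copy makes it negative and ends the recursion. *)
Lemma lift_fun_block i (q : int) d : (i < size js)%N ->
  1 <= q <= mu 0 (jth s js i) -> Apt i (q - 1) <= d < Apt i q ->
  Psi d = H (Apt i q - d)
    - \sum_(t < i) (mu 0 (jth s js t))%:~R * H (a 0 (jth s js t))
    - q%:~R * H (a 0 (jth s js i)).
Proof.
move=> ijs /andP[q1 qmu] /andP[h1 h2].
have [p qE] : exists p : nat, q = p.+1%:Z by exists (absz (q - 1)); lia.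
rewrite {}qE in q1 qmu h1 h2 *.
have := ijs => /S1plus_coefs_cat/(_ qmu)[L E].
have sumE (F : R -> R) :
    \sum_(c <- flatten [seq nseq (absz (mu 0 j)%R) (a 0 j) | j <- take i js]
    ++ nseq p (a 0 (jth s js i))) F c =
    \sum_(t < i) (mu 0 (jth s js t))%:~R * F (a 0 (jth s js t))
    + p%:R * F (a 0 (jth s js i)).
  rewrite big_cat big_nseq iter_addr_0 sum_flatten_nseq /= -[F _ *+ p]mulr_natl.
  rewrite (big_take_nth s _ (ltnW ijs)); congr (_ + _); apply: eq_bigr => t _.
  by rewrite natr_absz_ge0// (le_trans _ (mu_ge1 _)).
have pE : (p.+1%:Z)%:~R = p%:R + 1 :> R by rewrite -pmulrn natr1.
have pE' : (p.+1%:Z - 1)%:~R = p%:R :> R by rewrite intrD pE addrK.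
rewrite /Defs.Apt pE' in h1; rewrite /Defs.Apt pE in h2.
rewrite /Defs.Apt pE.
have L0 := S1plus_coefs_ge0; rewrite E all_cat in L0; case/andP: L0 => L0 _.
rewrite /Psi E lift_seq_cat// sumE ?sumE//.
rewrite lift_seq_cons ?subr_ge0//.
rewrite lift_seq_neg; last by lra.
set S := \sum_(t < i) _ * a 0 _; set c := a 0 (jth s js i).
rewrite (_ : - (d - (S + p%:R * c) - c) = S + (p%:R + 1) * c - d); last by ring.
by ring.
Qed.

Lemma lift_fun_last d : Astar <= d ->
  Psi d = H (Astar - d)
    - \sum_(t < size js) (mu 0 (jth s js t))%:~R * H (a 0 (jth s js t)).
Proof.
move=> h.
have sumE (F : R -> R) : \sum_(c <- S1plus_coefs) F c =
    \sum_(t < size js) (mu 0 (jth s js t))%:~R * F (a 0 (jth s js t)).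
  rewrite sum_flatten_nseq -{1}(take_size js) (big_take_nth s)//.
  apply: eq_bigr => t _.
  by rewrite natr_absz_ge0// (le_trans _ (mu_ge1 _)).
rewrite /Psi -[S1plus_coefs]cats0 lift_seq_cat ?S1plus_coefs_ge0 ?sumE//.
by rewrite lift_seq_nil opprB.
Qed.

Lemma block_exists d : 0 <= d -> d < Astar -> exists i (q : int),
  [/\ (i < size js)%N, 1 <= q <= mu 0 (jth s js i)
    & Apt i (q - 1) <= d < Apt i q].
Proof.
move=> d0 dA.
pose S i := \sum_(t < i) (mu 0 (jth s js t))%:~R * a 0 (jth s js t).
have exS : exists i, d < S i by exists (size js).
have [] := ex_minnP exS => -[|i]; first by rewrite /S big_ord0 ltNge d0.
move=> dS imin.
have Si : S i <= d by rewrite leNgt; apply/negP => /imin; rewrite ltnn.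
have ijs : (i < size js)%N by apply: imin.
move: dS; rewrite /S big_ord_recr /= -/(S i).
set c := a 0 (jth s js i) => dS.
have c0 : 0 < c.
  rewrite lt_neqAle a_ge0 andbT eq_sym; apply/eqP => c0.
  by move: dS; rewrite c0 mulr0 addr0 ltNge Si.
have e0 : 0 <= d - S i by rewrite subr_ge0.
(* Only the division with remainder of [d - S i] by [c] is taken from this lemma, hence the dummy
   function [id]. *)
have [p [h1 h2 _]] := periodizeP id c0 e0.
have pm : p%:Z < mu 0 (jth s js i).
  by rewrite -(ltr_int R) -(ltr_pM2r c0) -pmulrn; lra.
exists i, p.+1%:Z; split => //.
rewrite /Defs.Apt -/(S i) -/c.
have -> : p.+1%:Z - 1 = p%:Z by lia.
by rewrite -!pmulrn; lra.
Qed.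

Lemma mem_S1plus j :
  (j \in S1plus a mu s S1 k) = (j \in S1) && (b * slack%:R <= a 0 j).
Proof. by rewrite inE slackE !intrD intrN mulrC. Qed.

Lemma S1plus_coefs_ge : all (>= (b * slack%:R)%R) S1plus_coefs.
Proof.
have [_ jsE _] := js_enum.
apply/allP => c /flattenP[_ /mapP[j jjs ->]] /nseqP[-> _].
by move: jjs; rewrite jsE mem_S1plus => /andP[].
Qed.

Lemma jth_ge i : (i < size js)%N -> b * slack%:R <= a 0 (jth s js i).
Proof.
have [_ jsE _] := js_enum.
by move=> /(mem_nth s); rewrite -/(jth s js i) jsE mem_S1plus => /andP[].
Qed.

Lemma phiU_graph_exists d : 0 <= d -> exists y, phiU_graph f a mu s S1 k js d y.
Proof.
move=> d0; have b0 := as_gt0; have kM := k_le_mu.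
have sE := slackE.
have [dA|dA] := ltP d Astar.
  have [i [q [ijs qm /andP[h1 h2]]]] := block_exists d0 dA.
  have [h3|h3] := ltP d (Apt i q + (k - mu 0 s - 1)%:~R * b).
    by eexists; constructor 1; exists i, q; split => //; rewrite h1.
  have e0 : 0 <= b * slack%:R - (Apt i q - d).
    by move: h3; rewrite sE !intrD !intrN; lra.
  (* The quotient [j] is the index [l] of the piece; [d < Apt i q] bounds it by [mu_s - k]. *)
  have [j [g1 g2 _]] := periodizeP G as_gt0 e0.
  have jE : j.+1%:R = j%:Z%:~R + 1 :> R by rewrite -natr1 pmulrn.
  rewrite jE in g2; rewrite [j%:R]pmulrn in g1.
  eexists; constructor 2; exists i, q, j%:Z; split => //; last first.
    by move: g1 g2; rewrite sE !intrD !intrN; lra.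
  rewrite -ltzD1 -(ltr_int R) -(ltr_pM2l b0) !intrD intrN.
  by apply/andP; split => //; move: g1; rewrite sE; lra.
have e0 : 0 <= b * slack%:R - (Astar - d).
  have : 0 <= b * slack%:R by rewrite mulr_ge0// ltW.
  by lra.
have [j [g1 g2 _]] := periodizeP G as_gt0 e0.
have jE : j.+1%:R = j%:Z%:~R + 1 :> R by rewrite -natr1 pmulrn.
rewrite jE in g2; rewrite [j%:R]pmulrn in g1.
eexists; constructor 3; exists j%:Z; split => //; last first.
  by move: g1 g2; rewrite sE !intrD !intrN; lra.
rewrite -ltzD1 -(ltr_int R) -(ltr_pM2l b0) !intrD intrN.
by move: g2; rewrite sE; lra.
Qed.

(** The interval for [l] identifies the shift chosen by [H], that is [x_s = mu_s - l]. The
    alternative [l = 0] also admits a negative argument, as in piece (1). *)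
Lemma gap_tail_step (l : int) t : 0 <= l ->
  b * slack%:R - t < b * (l + 1)%:~R -> (l = 0 \/ b * l%:~R <= b * slack%:R - t) ->
  H t = G ((mu 0 s - l)%:~R * b - (k - 1)%:~R * b - t).
Proof.
move=> l0 h1 h2; have lE : l%:~R = (absz l)%:R :> R by rewrite natr_absz_ge0.
rewrite [RHS](_ : _ = G (b * slack%:R - t - b * l%:~R)); last first.
  by congr G; rewrite slackE !intrD !intrN; ring.
rewrite intrD lE in h1; rewrite lE in h2; rewrite lE.
rewrite /H /periodize_tail.
have [e0|e0] := leP (b * slack%:R - t) 0.
  case: h2 => [->|h2]; first by rewrite mulr0 subr0 periodize_neg.
  rewrite periodize_neg//; congr G.
  suff : 0 <= b * `|l|%:R by lra.
  by rewrite mulr_ge0// ltW.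
by apply: periodizeE => //; rewrite -?natr1//; case: h2 => // ->; rewrite mulr0 ltW.
Qed.

(** On each piece the interval determines where the recursion stops and which shift realises [H];
    the linear terms of the [zeta] values then combine to [slope * d]. The result is the same for
    all pieces, so the graph is single-valued. *)
Lemma phiU_graph_value d y : 0 <= d ->
  phiU_graph f a mu s S1 k js d y -> y = Psi d + slope * d.
Proof.
move=> d0; have b0 := as_gt0; have kM := k_le_mu; have k1 := k_ge1.
have bn0 := b_neq0; have sE := slackE.
have jE i (l : int) :
    Defs.Apt a mu s js i l = Defs.Apt a mu s js i (l - 1) + a 0 (jth s js i).
  by rewrite /Defs.Apt intrD; ring.
case=> [[i [q]]|[i [q [l]]]|[l]].
- case=> ijs qm /andP[h1 h2] ->.
  have h3 : d < Apt i q.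
    apply: lt_trans h2 _; rewrite gtrDl pmulr_llt0// ltrz0; lia.
  have := @lift_fun_block i q d ijs qm; rewrite h1 h3 => /(_ isT) ->.
  rewrite (@gap_tail_step 0 (Apt i q - d)) //; last 2 first.
  + by move: h2; rewrite sE !intrD !intrN; lra.
  + by left.
  rewrite zeta_sumE zetaE// gfunE.
  rewrite (_ : d + (mu 0 s)%:~R * b - Apt i q - (k - 1)%:~R * b =
    (mu 0 s - 0)%:~R * b - (k - 1)%:~R * b - (Apt i q - d)); last first.
    by rewrite subr0; ring.
  by rewrite /Defs.Apt intrB; field.
- case=> ijs qm lM /andP[h1 h2] ->.
  have h3 : d < Apt i q.
    apply: lt_le_trans h2 _; rewrite gerDl pmulr_lle0// lerz0; lia.
  have h4 : Apt i (q - 1) <= d.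
    apply: le_trans h1; rewrite [Apt i q]jE.
    (* Piece (2) starts no earlier than the block because the elements of [S1plus] are at least
       [beta]. *)
    have := jth_ge ijs; have : b * 0%:~R <= b * l%:~R by rewrite ler_pM2l// ler_int; lia.
    by rewrite sE !intrD !intrN; lra.
  have := @lift_fun_block i q d ijs qm; rewrite h3 h4 => /(_ isT) ->.
  rewrite (@gap_tail_step l (Apt i q - d)) //; last 3 first.
  + by lia.
  + by move: h2; rewrite sE !intrD !intrN; lra.
  + by right; move: h1; rewrite sE !intrD !intrN; lra.
  rewrite zeta_sumE zetaE// gfunE.
  rewrite (_ : d + (mu 0 s - l)%:~R * b - Apt i q - (k - 1)%:~R * b =
    (mu 0 s - l)%:~R * b - (k - 1)%:~R * b - (Apt i q - d)); last first.
    by ring.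
  by rewrite /Defs.Apt !intrD !intrN; field.
- case=> lM /andP[h1 h2] ->.
  have h4 : Astar <= d.
    apply: le_trans h1; rewrite lerDl mulr_ge0 ?(ltW b0)//; rewrite ler0z; lia.
  rewrite lift_fun_last// (@gap_tail_step l (Astar - d)) //; last 3 first.
  + by lia.
  + by move: h2; rewrite sE !intrD !intrN; lra.
  + by right; move: h1; rewrite sE !intrD !intrN; lra.
  rewrite zeta_sumE gfunE.
  rewrite (_ : d + (mu 0 s - l)%:~R * b - Astar - (k - 1)%:~R * b =
    (mu 0 s - l)%:~R * b - (k - 1)%:~R * b - (Astar - d)); last first.
    by ring.
  by rewrite /Defs.Astar !intrD !intrN; field.
Qed.

Lemma phiUE d : 0 <= d -> phiU f a mu s S1 k js d = Psi d + slope * d.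
Proof.
move=> d0; apply: phiU_graph_value => //.
exact: xgetPex (phiU_graph_exists d0).
Qed.

(** * Validity of the inequality *)

Variable S0 : {set 'I_n}.
Hypotheses (s_notin_S0 : s \notin S0) (s_notin_S1 : s \notin S1).
Hypothesis S0_S1_disjoint : forall i, i \in S0 -> i \notin S1.
Hypothesis S0_S1_cover : forall i, [|| i == s, i \in S0 | i \in S1].

Let G_chords := chord_gap_chords.
Let H_le := @periodize_tail_subadd_le _ _ _ G_chords as_gt0 chord_gap0 chord_gapb
  slack.
Let H_ge0 := @periodize_tail_subadd_ge0 _ _ _ G_chords as_gt0 chord_gap0 chord_gapb
  slack.
Let H_increment := @periodize_tail_increment _ _ _ G_chords as_gt0 chord_gap0 chord_gapb
  slack.
Let H_0 : H 0 = 0. Proof. exact: periodize_tail0 as_gt0 chord_gap0 _. Qed.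

Let beta_ge0 : 0 <= b * slack%:R. Proof. by rewrite mulr_ge0// ltW. Qed.

Lemma S1plus_coefs_sorted : sorted >=%R S1plus_coefs.
Proof.
have [_ _ js_sorted] := js_enum.
by apply: sorted_flatten_nseq => //; [exact: ge_refl | exact: ge_trans].
Qed.

Lemma sum_js (F : 'I_n -> R) :
  \sum_(j <- js) F j = \sum_(j in S1 | b * slack%:R <= a 0 j) F j.
Proof.
have [js_uniq jsE _] := js_enum.
by rewrite big_uniq//; apply: eq_bigl => j; rewrite jsE mem_S1plus.
Qed.

(** Elements below [beta] are split off by subadditivity of [H], on one half-line or the other
    according to the remainder. The others, with multiplicities [y], form a sublist of
    [S1plus_coefs], whose gain the recursion dominates. *)
Lemma gap_tail_le_lift_fun (y : 'I_n -> nat) d :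
  (forall j, y j <= absz (mu 0 j)%R)%N ->
  H (\sum_(j in S1) (y j)%:R * a 0 j - d)
    <= \sum_(j in S1) (y j)%:R * H (a 0 j) + Psi d.
Proof.
move=> ymu; pose big j := b * slack%:R <= a 0 j.
rewrite (bigID big) [X in _ <= X + _](bigID big) /= addrAC [X in H X]addrC.
set T := \sum_(j in S1 | big j) (y j)%:R * a 0 j.
apply: le_trans (@subadd_sum _ _ _ predT H (fun j => a 0 j) y (T - d) _ _ _) _.
- by [].
- move=> i u /andP[_ ilt] _; rewrite addrC [leRHS]addrC.
  move: ilt; rewrite /big -ltNge => /ltW ilt.
  have [ub|/ltW ub] := leP u (b * slack%:R); first exact: H_le.
  by apply: H_ge0 => //; exact: le_trans ub.
- by [].
suff : H (T - d) - \sum_(j in S1 | big j) (y j)%:R * H (a 0 j) <= Psi d by lra.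
rewrite /T -!sum_js.
rewrite -(sum_flatten_nseq js y (a 0) id) -(sum_flatten_nseq js y (a 0) H) /=.
apply: (lift_seq_ge_subseq beta_ge0 H_0 H_ge0 H_increment).
- exact: subseq_flatten_nseq.
- exact: S1plus_coefs_sorted.
- exact: S1plus_coefs_ge.
Qed.

Lemma lift_fun_sum (x : 'I_n -> nat) :
  Psi (\sum_(i in S0) (x i)%:R * a 0 i) <= \sum_(i in S0) (x i)%:R * Psi (a 0 i).
Proof.
have := @subadd_sum _ _ (mem S0) (>= 0) Psi (fun j => a 0 j) x 0.
rewrite !addr0 [Psi 0](lift_seq0 H_0 S1plus_coefs_ge0) addr0; apply => //.
- by move=> i u _ u0; rewrite /= addr_ge0.
- move=> i u _ u0.
  apply: (lift_seq_subadd beta_ge0 H_0 H_le H_ge0 H_increment) => //.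
    exact: S1plus_coefs_sorted.
  exact: S1plus_coefs_ge.
Qed.

Definition lifted_rhs (v : 'rV[R]_n) : R :=
  \sum_(i in S1) zeta (- a 0 i) * ((mu 0 i)%:~R - v 0 i)
  + \sum_(i in S0) phiU f a mu s S1 k js (a 0 i) * v 0 i
  + rho * (v 0 s - k%:~R) + g (k%:~R * b).

Lemma sum_partition (F : 'I_n -> R) :
  \sum_i F i = F s + \sum_(i in S0) F i + \sum_(i in S1) F i.
Proof.
rewrite (bigD1 s)//= (bigID (mem S0)) /= addrA; congr (_ + _ + _).
  apply: eq_bigl => i; rewrite andbC; case: (boolP (i \in S0)) => //= iS0.
  by apply: contraNneq s_notin_S0 => <-.
apply: eq_bigl => i; have := S0_S1_cover i; have := S0_S1_disjoint (i := i).
case: eqP => [->|_] /=; first by rewrite (negbTE s_notin_S1).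
by case: (i \in S0) => /=; [move=> /(_ isT)/negbTE -> | move=> _ ->].
Qed.

(** All linear terms cancel, so both validity and tightness become statements about [G], [H] and
    [Psi] alone. *)
Lemma lifted_rhs_gap (x : 'rV[int]_n) :
  lifted_rhs (map_mx intr x) - f (\sum_i a 0 i * (x 0 i)%:~R) =
  \sum_(i in S1) (mu 0 i - x 0 i)%:~R * H (a 0 i)
  + \sum_(i in S0) (x 0 i)%:~R * Psi (a 0 i)
  - G ((x 0 s)%:~R * b - (k - 1)%:~R * b
       - (\sum_(i in S1) (mu 0 i - x 0 i)%:~R * a 0 i
          - \sum_(i in S0) (x 0 i)%:~R * a 0 i)).
Proof.
set T := \sum_(i in S1) (mu 0 i - x 0 i)%:~R * a 0 i.
set D := \sum_(i in S0) (x 0 i)%:~R * a 0 i.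
have -> : f (\sum_i a 0 i * (x 0 i)%:~R) = g ((x 0 s)%:~R * b - (T - D)).
  rewrite /gfun sum_partition; congr f.
  have -> : T = \sum_(i in S1) (mu 0 i)%:~R * a 0 i - \sum_(i in S1) a 0 i * (x 0 i)%:~R.
    by rewrite -sumrB; apply: eq_bigr => i _; rewrite intrB; ring.
  have -> : D = \sum_(i in S0) a 0 i * (x 0 i)%:~R.
    by apply: eq_bigr => i _; rewrite mulrC.
  by ring.
rewrite gfunE /lifted_rhs mxE.
have -> : \sum_(i in S1) zeta (- a 0 i) * ((mu 0 i)%:~R - (map_mx intr x : 'rV[R]_n) 0 i)
    = \sum_(i in S1) (mu 0 i - x 0 i)%:~R * H (a 0 i) - slope * T.
  rewrite mulr_sumr -sumrB; apply: eq_bigr => i _.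
  by rewrite mxE zetaE// intrB; ring.
have -> : \sum_(i in S0) phiU f a mu s S1 k js (a 0 i) * (map_mx intr x : 'rV[R]_n) 0 i
    = \sum_(i in S0) (x 0 i)%:~R * Psi (a 0 i) + slope * D.
  rewrite mulr_sumr -big_split; apply: eq_bigr => i _ /=.
  by rewrite mxE phiUE//; ring.
rewrite (_ : _ * b - (T - D) - _ =
  (x 0 s)%:~R * b - (k - 1)%:~R * b - (T - D)); last by ring.
by have bn0 := b_neq0; field.
Qed.

Lemma lifted_rhs_valid (x : 'rV[int]_n) : (forall i, 0 <= x 0 i <= mu 0 i) ->
  f (\sum_i a 0 i * (x 0 i)%:~R) <= lifted_rhs (map_mx intr x).
Proof.
move=> xmu; rewrite -subr_ge0 lifted_rhs_gap subr_ge0.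
have x0 i : 0 <= x 0 i by case/andP: (xmu i).
have mux i : 0 <= mu 0 i - x 0 i by case/andP: (xmu i) => _; rewrite subr_ge0.
have xsM : x 0 s <= mu 0 s by case/andP: (xmu s).
(* The chain bounds [G] by [H], then [H] by the [S1] terms plus [Psi] of the [S0] load, and finally
   splits [Psi] over [S0]. *)
apply: le_trans (gap_tail_ge _ xsM) _.
pose y i := absz (mu 0 i - x 0 i)%R.
have yE (F : 'I_n -> R) :
    \sum_(i in S1) (mu 0 i - x 0 i)%:~R * F i = \sum_(i in S1) (y i)%:R * F i.
  by apply: eq_bigr => i _; rewrite natr_absz_ge0.
have xE (F : 'I_n -> R) :
    \sum_(i in S0) (x 0 i)%:~R * F i = \sum_(i in S0) (absz (x 0 i)%R)%:R * F i.
  by apply: eq_bigr => i _; rewrite natr_absz_ge0.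
rewrite !yE !xE; apply: le_trans (gap_tail_le_lift_fun _ _) _.
  by move=> j; rewrite /y; have := x0 j; have := mux j; lia.
by rewrite lerD2l lift_fun_sum.
Qed.

(** * Tight points *)

Lemma Astar_sum : Astar = \sum_(j in S1plus a mu s S1 k) (mu 0 j)%:~R * a 0 j.
Proof.
rewrite /Defs.Astar; under [RHS]eq_bigl do rewrite mem_S1plus.
rewrite -sum_js -(big_take_nth s (fun j => (mu 0 j)%:~R * a 0 j) (leqnn _)).
by rewrite take_size.
Qed.

(** The upper bound on [d] keeps the argument of [H] at least [- k b], the range where the maximum
    is attained by an admissible [x_s]. *)
Lemma lift_fun_attained_prefix d : 0 <= d -> d <= Astar + k%:~R * b ->
  exists i (q : int), [/\ (i <= size js)%N, 0 <= q <= mu 0 (jth s js i),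
    i = size js -> q = 0, - (k%:~R * b) <= Apt i q - d &
    Psi d = H (Apt i q - d)
      - \sum_(t < i) (mu 0 (jth s js t))%:~R * H (a 0 (jth s js t))
      - q%:~R * H (a 0 (jth s js i))].
Proof.
move=> d0 dk; have [dA|Ad] := ltP d Astar.
  have [i [q [ijs qm hq]]] := block_exists d0 dA.
  have kb : 0 <= k%:~R * b by rewrite mulr_ge0 ?ler0z// ?ltW//; lia.
  exists i, q; split;
    [exact: ltnW | by lia | by move: ijs => /[swap] ->; rewrite ltnn | | exact: lift_fun_block].
  by case/andP: hq; lra.
have AE : Apt (size js) 0 = Astar by rewrite /Defs.Apt mul0r addr0.
(* The list is exhausted: [jth] returns its default [s], which is multiplied by [q = 0]. *)
exists (size js), 0; split; rewrite ?AE//.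
- by have := mu_ge1 (jth s js (size js)); lia.
- by lra.
- by rewrite mul0r subr0 lift_fun_last.
Qed.

Lemma lift_fun_attained d : 0 <= d -> d <= Astar + k%:~R * b ->
  exists (y : 'I_n -> int) (x : int), [/\ forall j, 0 <= y j <= mu 0 j,
    0 <= x <= mu 0 s &
    \sum_(j in S1) (y j)%:~R * H (a 0 j) + Psi d
      = G (x%:~R * b - (k - 1)%:~R * b - (\sum_(j in S1) (y j)%:~R * a 0 j - d))].
Proof.
have [js_uniq jsE _] := js_enum.
move=> d0 dk; have [i [q [ijs qm iq kA PsiE]]] := lift_fun_attained_prefix d0 dk.
(* The deficits [mu_j - x_j] on [S1] follow the recursion: full blocks before [i], then [q] copies.
   The membership test separates absent elements, whose [index] is [size js]. *)
pose y j := if (index j js < i)%N then mu 0 j else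
  if (j \in js) && (index j js == i) then q else 0.
have mu_ge0 j : 0 <= mu 0 j by exact: le_trans (mu_ge1 j).
have yE (F : 'I_n -> R) : \sum_(j in S1) (y j)%:~R * F j =
    \sum_(t < i) (mu 0 (jth s js t))%:~R * F (jth s js t)
    + q%:~R * F (jth s js i).
  rewrite (bigID (fun j => b * slack%:R <= a 0 j)) /= -sum_js.
  rewrite [X in _ + X]big1 ?addr0; last first.
    move=> j /andP[jS1 jb]; have jjs : j \notin js by rewrite jsE mem_S1plus jS1.
    by rewrite /y (negbTE jjs) memNindex// ltnNge ijs mul0r.
  rewrite (big_nth s) (big_cat_nat _ ijs)//=; congr (_ + _).
    rewrite big_mkord; apply: eq_bigr => t _.
    by rewrite /y index_uniq// ?ltn_ord// (leq_trans (ltn_ord t)).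
  move: ijs; rewrite leq_eqVlt => /predU1P[isz|ijs].
    by rewrite isz big_geq// iq// mul0r.
  rewrite big_ltn// /y mem_nth// index_uniq// ltnn eqxx /= -/(jth s js i).
  rewrite big_nat_cond big1 ?addr0// => t /andP[/andP[it ts] _].
  by rewrite index_uniq// ltnNge (ltnW it) /= gtn_eqF// andbF mul0r.
have [x xM xE] := gap_tail_attained kA.
exists y, x; split => //.
  move=> j; have muj := mu_ge0 j.
  rewrite /y; case: ifP => _; first by lia.
  case: ifP => [/andP[jjs /eqP ij]|_]; last by lia.
  by move: qm; rewrite -ij /jth nth_index.
by rewrite !yE -xE PsiE /Defs.Apt; ring.
Qed.

(** For [j] in [S0], set [x_j = 1] and take the deficits from the recursion; for [j] in [S1], lower
    [x_j] by one from its bound and let [x_s] attain [H]; for [j = s], take [x_s = k - 1], where the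
    chord meets [g]. *)
Lemma lifted_rhs_tight_points :
  (forall i, i \in S0 -> a 0 i <= Astar + k%:~R * b) ->
  forall j : 'I_n, exists x : 'rV[int]_n,
  [/\ forall i, 0 <= x 0 i <= mu 0 i,
      f (\sum_i a 0 i * (x 0 i)%:~R) = lifted_rhs (map_mx intr x),
      forall i, i \in S0 -> x 0 i = (i == j)%:R,
      j \notin S0 -> forall i, i \in S1 -> x 0 i = mu 0 i - (i == j)%:R
    & j = s -> x 0 s = k - 1].
Proof.
move=> aA j.
suff [y [x [yb xb E jS0 js']]] : exists (y : 'I_n -> int) (x : int),
  [/\ forall i, 0 <= y i <= mu 0 i, 0 <= x <= mu 0 s,
    \sum_(i in S1) (y i)%:~R * H (a 0 i) + (j \in S0)%:R * Psi (a 0 j)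
      = G (x%:~R * b - (k - 1)%:~R * b
           - (\sum_(i in S1) (y i)%:~R * a 0 i - (j \in S0)%:R * a 0 j)),
    j \notin S0 -> forall i, i \in S1 -> y i = (i == j)%:R
    & j = s -> x = k - 1].
  pose v := \row_i (if i == s then x else
    if i \in S1 then mu 0 i - y i else (i == j)%:R).
  have vs : v 0 s = x by rewrite mxE eqxx.
  have vS1 i : i \in S1 -> v 0 i = mu 0 i - y i.
    move=> iS1; rewrite mxE iS1; case: eqP => // is_.
    by move: iS1; rewrite is_ (negbTE s_notin_S1).
  have vS0 i : i \in S0 -> v 0 i = (i == j)%:R.
    move=> iS0; rewrite mxE (negbTE (S0_S1_disjoint iS0)); case: eqP => // is_.
    by move: iS0; rewrite is_ (negbTE s_notin_S0).
  exists v; split => //.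
  - move=> i; rewrite mxE; case: eqP => [->//|_].
    case: ifP => _; first by have := yb i; lia.
    by have := mu_ge1 i; case: (i == j) => /=; lia.
  - apply/esym/eqP; rewrite -subr_eq0 lifted_rhs_gap vs.
    have S1E (F : 'I_n -> R) : \sum_(i in S1) (mu 0 i - v 0 i)%:~R * F i
        = \sum_(i in S1) (y i)%:~R * F i.
      by apply: eq_bigr => i iS1; rewrite vS1// opprB addrC subrK.
    have S0E (F : 'I_n -> R) : \sum_(i in S0) (v 0 i)%:~R * F i
        = (j \in S0)%:R * F j.
      under eq_bigr => i iS0 do rewrite vS0//.
      case: (boolP (j \in S0)) => jS0'.
        rewrite (bigD1 j)//= eqxx big1 ?addr0// => i /andP[_ /negbTE ->].
        by rewrite mul0r.
      rewrite mul0r big1// => i iS0; case: eqP => [ij|_]; last by rewrite mul0r.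
      by rewrite -ij iS0 in jS0'.
    by rewrite !S1E !S0E E subrr.
  - by move=> jS0' i iS1; rewrite vS1// jS0.
  - by rewrite vs.
have kb : 0 <= k%:~R * b by rewrite mulr_ge0 ?ler0z// ?ltW//; lia.
have [jS0|jNS0] := boolP (j \in S0).
  have [y [x [yb xb E]]] := lift_fun_attained (a_ge0 j) (aA j jS0).
  exists y, x; split => //; first by rewrite !mul1r.
  by move=> js'; rewrite js' (negbTE s_notin_S0) in jS0.
exists (fun i => ((i == j) && (i \in S1))%:R).
have sumE (F : 'I_n -> R) : \sum_(i in S1) (((i == j) && (i \in S1))%:R)%:~R * F i
    = (j \in S1)%:R * F j.
  case: (boolP (j \in S1)) => jS1.
    rewrite (bigD1 j)//= eqxx jS1 big1 ?addr0// => i /andP[_ /negbTE ->].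
    by rewrite mul0r.
  rewrite mul0r big1// => i iS1; case: eqP => [ij|_]; last by rewrite mul0r.
  by rewrite -ij iS1 in jS1.
have [jS1|jNS1] := boolP (j \in S1).
  have [|x xb E] := @gap_tail_attained (a 0 j).
    by apply: le_trans (a_ge0 j); rewrite oppr_le0.
  exists x; split => //.
  - by move=> i; have := mu_ge1 i; case: (i == j); case: (i \in S1) => /=; lia.
  - by rewrite !sumE jS1 !mul1r !mul0r addr0 subr0 E.
  - by move=> _ i ->; rewrite andbT.
  - by move=> js'; rewrite js' (negbTE s_notin_S1) in jS1.
exists (k - 1); split => //.
- by move=> i; have := mu_ge1 i; case: (i == j); case: (i \in S1) => /=; lia.
- by lia.
- by rewrite !sumE (negbTE jNS1) !mul0r !subr0 addr0 subrr chord_gap0.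
- by move=> _ i ->; rewrite andbT.
Qed.

Lemma lifted_rhs_tight_base : exists x : 'rV[int]_n,
  [/\ forall i, 0 <= x 0 i <= mu 0 i,
      f (\sum_i a 0 i * (x 0 i)%:~R) = lifted_rhs (map_mx intr x),
      forall i, i \in S0 -> x 0 i = 0,
      forall i, i \in S1 -> x 0 i = mu 0 i
    & x 0 s = k].
Proof.
pose v : 'rV[int]_n := \row_i (if i == s then k else
    if i \in S1 then mu 0 i else 0).
have vs : v 0 s = k by rewrite mxE eqxx.
have vS1 i : i \in S1 -> v 0 i = mu 0 i.
  move=> iS1; rewrite mxE iS1; case: eqP => // is_.
  by move: iS1; rewrite is_ (negbTE s_notin_S1).
have vS0 i : i \in S0 -> v 0 i = 0.
  move=> iS0; rewrite mxE (negbTE (S0_S1_disjoint iS0)); case: eqP => // is_.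
  by move: iS0; rewrite is_ (negbTE s_notin_S0).
exists v; split => //.
  move=> i; rewrite mxE; case: eqP => [->|_]; first by lia.
  by have := mu_ge1 i; case: ifP; lia.
apply/esym/eqP; rewrite -subr_eq0 lifted_rhs_gap vs.
rewrite !big1 => [|i iS|i iS|i iS|i iS]; last 4 first.
- by rewrite vS0// mul0r.
- by rewrite vS1// subrr mul0r.
- by rewrite vS0// mul0r.
- by rewrite vS1// subrr mul0r.
rewrite (_ : k%:~R * b - (k - 1)%:~R * b - _ = b).
  by rewrite chord_gapb !addr0 subrr.
by rewrite intrB; ring.
Qed.

(** * The affine form of the inequality and affine independence *)

Definition lifted_normal : 'cV[R]_n := \col_i
  (if i == s then rho else
   if i \in S1 then - zeta (- a 0 i) else phiU f a mu s S1 k js (a 0 i)).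

Definition lifted_const : R :=
  \sum_(i in S1) zeta (- a 0 i) * (mu 0 i)%:~R - rho * k%:~R + g (k%:~R * b).

Lemma lifted_rhsE v : lifted_rhs v = (v *m lifted_normal) 0 0 + lifted_const.
Proof.
rewrite mxE sum_partition mxE eqxx.
rewrite [X in _ = _ + X + _](_ : _ = - \sum_(i in S1) zeta (- a 0 i) * v 0 i); last first.
  rewrite -sumrN; apply: eq_bigr => i iS1; rewrite mxE iS1 ifN.
    by rewrite mulrN mulrC.
  by apply: contraNneq s_notin_S1 => <-.
rewrite [X in _ = _ + X - _ + _](_ : _ =
    \sum_(i in S0) phiU f a mu s S1 k js (a 0 i) * v 0 i); last first.
  apply: eq_bigr => i iS0; rewrite mxE ifN.
    by rewrite (negbTE (S0_S1_disjoint iS0)) mulrC.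
  by apply: contraNneq s_notin_S0 => <-.
rewrite /lifted_rhs /lifted_const.
have -> : \sum_(i in S1) zeta (- a 0 i) * ((mu 0 i)%:~R - v 0 i) =
    \sum_(i in S1) zeta (- a 0 i) * (mu 0 i)%:~R
    - \sum_(i in S1) zeta (- a 0 i) * v 0 i.
  by rewrite -sumrB; apply: eq_bigr => i _; rewrite mulrBr.
by ring.
Qed.

(** A coordinate in [S0] is nonzero at its own point only, so that coefficient vanishes. In a
    coordinate of [S1] the common value [mu_i] cancels because the coefficients sum to 0. Two points
    remain, separated by [x_s = k] and [x_s = k - 1]. *)
Lemma tight_points_aff_indep (t : 'I_n.+1 -> (R^o * 'rV[R]_n)%type)
    (x : 'I_n.+1 -> 'rV[int]_n) :
  (forall j, (t j).2 = map_mx intr (x j)) ->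
  (forall i, i \in S0 -> x ord0 0 i = 0) ->
  (forall i, i \in S1 -> x ord0 0 i = mu 0 i) ->
  x ord0 0 s = k ->
  (forall j i, i \in S0 -> x (lift ord0 j) 0 i = (i == j)%:R) ->
  (forall j, j \notin S0 -> forall i, i \in S1 ->
    x (lift ord0 j) 0 i = mu 0 i - (i == j)%:R) ->
  x (lift ord0 s) 0 s = k - 1 ->
  aff_indep t.
Proof.
move=> tE x0S0 x0S1 x0s xS0 xS1 xs c; rewrite big_ord_recl => c_sum ct.
have coord i : c ord0 * (x ord0 0 i)%:~R
    + \sum_j c (lift ord0 j) * (x (lift ord0 j) 0 i)%:~R = 0.
  transitivity (\sum_j c j * (x j 0 i)%:~R); first by rewrite big_ord_recl.
  have := congr1 (fun p : R^o * 'rV[R]_n => p.2 0 i) ct.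
  rewrite sum_pair /= summxE mxE => h; rewrite -[RHS]h; apply: eq_bigr => j _.
  by rewrite mxE tE mxE.
have pick i : \sum_j c (lift ord0 j) * (i == j)%:R = c (lift ord0 i).
  rewrite (bigD1 i)//= eqxx mulr1 big1 ?addr0// => j; rewrite eq_sym => /negbTE ->.
  by rewrite mulr0.
have cS0 i : i \in S0 -> c (lift ord0 i) = 0.
  move=> iS0; have := coord i; rewrite x0S0// mulr0 add0r => h.
  rewrite -[RHS]h -pick.
  by apply: eq_bigr => j _; rewrite xS0//; case: (i == j).
have cS1 i : i \in S1 -> c (lift ord0 i) = 0.
  move=> iS1; have := coord i; rewrite x0S1//.
  have -> : \sum_j c (lift ord0 j) * (x (lift ord0 j) 0 i)%:~R
      = (mu 0 i)%:~R * (\sum_j c (lift ord0 j)) - c (lift ord0 i).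
    rewrite -pick mulr_sumr -sumrB; apply: eq_bigr => j _.
    have [jS0|jS0] := boolP (j \in S0); first by rewrite cS0// !mul0r mulr0 subrr.
    by rewrite xS1// intrB; case: (i == j); rewrite /= ?mulr1z ?mulr0z; ring.
  have -> : \sum_j c (lift ord0 j) = - c ord0.
    by apply/eqP; rewrite -addr_eq0 addrC c_sum.
  by move=> h; apply/eqP; rewrite -oppr_eq0; apply/eqP; rewrite -[RHS]h; ring.
have cNs i : i != s -> c (lift ord0 i) = 0.
  by move=> is_; have /or3P[/eqP h|/cS0//|/cS1//] := S0_S1_cover i; rewrite h eqxx in is_.
have := coord s; rewrite (bigD1 s)//= big1; last by move=> j /cNs ->; rewrite mul0r.
rewrite x0s xs addr0 intrB.
move: c_sum; rewrite (bigD1 s)//= big1; last by move=> j /cNs.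
rewrite addr0 => /eqP; rewrite addr_eq0 => /eqP c0E.
rewrite c0E => cs.
have {}cs : c (lift ord0 s) = 0 by move: cs; lra.
move=> i; have [j ->|->] := unliftP ord0 i; last by rewrite c0E cs oppr0.
by have [->|/cNs] := eqVneq j s.
Qed.

End Coefficients.

(** * Validity and the facet property *)

Theorem theorem4p19 (R : realType) (n : nat) (f : R -> R)
    (a : 'rV[R]_n) (mu : 'rV[int]_n) (s : 'I_n) (S0 S1 : {set 'I_n})
    (k : int) (js : seq 'I_n)
    (n_ge1 : (1 <= n)%N)
    (f_concave : concave f)
    (a_ge0 : forall i, 0 <= a 0 i)
    (mu_ge1 : forall i, 1 <= mu 0 i)
    (as_gt0 : 0 < a 0 s)
    (s_notin_S0 : s \notin S0)
    (s_notin_S1 : s \notin S1)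
    (S0_S1_disjoint : forall i, i \in S0 -> i \notin S1)
    (S0_S1_cover : forall i, [|| i == s, i \in S0 | i \in S1])
    (k_bounds : 1 <= k <= mu 0 s)
    (js_enum : S1plus_enum a mu s S1 k js) :
  let g := gfun f a mu S1 in
  let zeta := zeta f a mu s S1 k in
  let phi := phiU f a mu s S1 k js in
  let lhs := fun p : (R^o * 'rV[R]_n)%type => (p.1 : R) in
  let rhs := fun p : (R^o * 'rV[R]_n)%type =>
    \sum_(i in S1) zeta (- a 0 i) * ((mu 0 i)%:~R - p.2 0 i)
    + \sum_(i in S0) phi (a 0 i) * p.2 0 i
    + rho f a mu s S1 k * (p.2 0 s - k%:~R) + g (k%:~R * a 0 s) in
  valid_ineq lhs rhs (mixed_set f a mu) /\
  ((forall i, i \in S0 ->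
      0 <= a 0 i <= \sum_(j in S1plus a mu s S1 k) (mu 0 j)%:~R * a 0 j
                    + k%:~R * a 0 s) ->
   facet_defining lhs rhs (conv_hull (mixed_set f a mu))).
Proof.
move=> g z phi lhs rhs.
have /andP[k_ge1 k_le_mu] := k_bounds.
have rhsE p : rhs p = lifted_rhs f a mu s S1 k js S0 p.2 by [].
have valid : valid_ineq lhs rhs (mixed_set f a mu).
  move=> p [x [px wx xb]]; rewrite rhsE px; apply: le_trans wx _.
  exact: lifted_rhs_valid.
split=> // aA.
have aA' i : i \in S0 -> a 0 i <= Astar a mu s js + k%:~R * a 0 s.
  move=> iS0; have /andP[_] := aA i iS0.
  by rewrite (Astar_sum as_gt0 k_ge1 k_le_mu js_enum).
have [x0 [x0b x0t x0S0 x0S1 x0s]] := lifted_rhs_tight_base f_concave a_ge0 mu_ge1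
  as_gt0 k_ge1 k_le_mu js_enum s_notin_S0 s_notin_S1 S0_S1_disjoint S0_S1_cover.
have [X XP] := choice (lifted_rhs_tight_points f_concave a_ge0 mu_ge1 as_gt0
  k_ge1 k_le_mu js_enum s_notin_S0 s_notin_S1 S0_S1_disjoint S0_S1_cover aA').
pose x i := if unlift ord0 i is Some j then X j else x0.
pose t i : (R^o * 'rV[R]_n)%type :=
  (f (\sum_l a 0 l * (x i 0 l)%:~R), map_mx intr (x i)).
have xb i l : 0 <= x i 0 l <= mu 0 l.
  by rewrite /x; case: unlift => [j|//]; case: (XP j).
have xt i : f (\sum_l a 0 l * (x i 0 l)%:~R) =
    lifted_rhs f a mu s S1 k js S0 (map_mx intr (x i)).
  by rewrite /x; case: unlift => [j|//]; case: (XP j).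
have xlift j : x (lift ord0 j) = X j by rewrite /x liftK.
have x_ord0 : x ord0 = x0 by rewrite /x unlift_none.
(* Lowering [w] by one at the base point gives the non-tight point. *)
apply: (@facet_defining_conv_hull _ _ (lifted_normal f a mu s S1 k js)
  (lifted_const f a mu s S1 k) rhs _ _ t ((t ord0).1 - 1, (t ord0).2)) => //.
- by move=> p; rewrite rhsE; apply: lifted_rhsE.
- apply: (tight_points_aff_indep (mu := mu) (S1 := S1) (k := k) (x := x)
    S0_S1_cover) => //;
    rewrite ?x_ord0//.
  + by move=> j i; rewrite xlift; case: (XP j) => _ _ h _ _; exact: h.
  + by move=> j; rewrite xlift; case: (XP j).
  + by rewrite xlift; case: (XP s) => _ _ _ _; apply.
- by move=> i; split; [exists (x i) | rewrite rhsE; exact: xt].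
- by exists (x ord0); split => //=; rewrite gerBl.
- by rewrite rhsE /= -xt /lhs /= => h; move: h; lra.
Qed.
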